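(* Let $H$ be a bipartite graph, and let $k_1 = \min \max(|A|,|B|)$ and $k_2 = \min \min(|A|,|B|)$, where both minima range over all partitions $(A,B)$ of $V(H)$ into two independent sets. Fix $p \in (0,1)$, let $d = 1/(1-p)$, and let $G \sim G(n,p)$. (i) If $k_1 \ge 3$ and $k_2 \ge 2$, then there is a constant $C = C(H,p)$ such that with high probability $$\frac{n}{k_1 - 1} - C\log n \le \chi_H(G) \le \frac{n}{k_1-1} + O\!\left(\frac{n}{\log_d n}\right).$$ (ii) If $k_1 = k_2 = 2$, then there is a constant $C = C(H,p)$ such that with high probability $$n - C\log n \le \chi_H(G) \le n - 2\log_d n + O(\log_d \log n).$$ (iii) In particular, for $H = 2K_2$, with $Q = 1 - 2p^2(1-p)^2$, with high probability $$n - 8\log_{1/Q} n + \Omega(\log_{1/Q}\log n) \le \chi_{2K_2}(G) \le n - 2\log_d n + O(\log_d \log n).$$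
   Context: All graphs are finite and simple. For a fixed bipartite graph $H$, a proper vertex coloring of a graph $G$ is called an $H$-avoiding coloring if for any two color classes, the subgraph of $G$ induced by their union contains no induced subgraph isomorphic to $H$. $\chi_H(G)$ denotes the minimum number of colors in an $H$-avoiding coloring of $G$. $G(n,p)$ is the Erdős–Rényi random graph on $n$ vertices with independent edge probability $p$. ''With high probability'' means with probability tending to 1 as $n \to \infty$. $\log$ is the natural logarithm and $\log_b$ the logarithm to base $b$. $2K_2$ is the disjoint union of two edges. *)

(* Defs.v *)
From HB Require Import structures.
From mathcomp Require Import all_boot all_order all_algebra.
From mathcomp Require Import reals exp.
Set Implicit Arguments. Unset Strict Implicit. Unset Printing Implicit Defensive.
Import Order.TTheory GRing.Theory Num.Theory.

(* A graph on vertex set 'I_n is encoded by its edge set E, a set of pairs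
   (x,y) with x < y (each unordered edge stored once). *)
Definition upairs (n : nat) : {set 'I_n * 'I_n} :=
  [set xy : 'I_n * 'I_n | (xy.1 < xy.2)%N].

Definition gadj (n : nat) (E : {set 'I_n * 'I_n}) : rel 'I_n :=
  fun x y => ((x, y) \in E) || ((y, x) \in E).

Definition simple_graph (V : finType) (e : rel V) : Prop :=
  symmetric e /\ irreflexive e.

Definition independent (V : finType) (e : rel V) (A : {set V}) : bool :=
  [forall x in A, forall y in A, ~~ e x y].

Definition bipartition (V : finType) (e : rel V) (A : {set V}) : bool :=
  independent e A && independent e (~: A).

Definition bipartite (V : finType) (e : rel V) : Prop :=
  exists A : {set V}, bipartition e A.

(* k1 = min over bipartitions of max(|A|,|B|); k2 = min of min(|A|,|B|).
   (#|V| is a neutral default, as every value is <= #|V|.) *)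
Definition k1 (V : finType) (e : rel V) : nat :=
  \big[minn/#|V|]_(A : {set V} | bipartition e A) maxn #|A| #|~: A|.
Definition k2 (V : finType) (e : rel V) : nat :=
  \big[minn/#|V|]_(A : {set V} | bipartition e A) minn #|A| #|~: A|.

Definition proper_col (n k : nat) (E : {set 'I_n * 'I_n}) (c : {ffun 'I_n -> 'I_k}) : bool :=
  [forall x, forall y, gadj E x y ==> (c x != c y)].

Definition induced_copy_in (V : finType) (e : rel V) (n k : nat)
    (E : {set 'I_n * 'I_n}) (c : {ffun 'I_n -> 'I_k}) (i j : 'I_k) : bool :=
  [exists f : {ffun V -> 'I_n},
     [&& injectiveb f,
         [forall v, (c (f v) == i) || (c (f v) == j)] &
         [forall v, forall w, e v w == gadj E (f v) (f w)]]].

Definition H_avoiding (V : finType) (e : rel V) (n k : nat)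
    (E : {set 'I_n * 'I_n}) (c : {ffun 'I_n -> 'I_k}) : bool :=
  proper_col E c &&
  [forall i, forall j, (i != j) ==> ~~ induced_copy_in e E c i j].

(* chi_H(G): least k <= n admitting an H-avoiding colouring with k colours
   (returns n.+1 if none exists; for the H considered below, k = n works). *)
Definition chiH (V : finType) (e : rel V) (n : nat) (E : {set 'I_n * 'I_n}) : nat :=
  find (fun k => [exists c : {ffun 'I_n -> 'I_k}, H_avoiding e E c]) (iota 0 n.+1).

Local Open Scope ring_scope.

Definition gnp_prob (R : realType) (p : R) (n : nat)
    (P : {set 'I_n * 'I_n} -> bool) : R :=
  \sum_(E : {set 'I_n * 'I_n} | E \subset upairs n)
     p ^+ #|E| * (1 - p) ^+ (#|upairs n| - #|E|)%N * (P E)%:R.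

Definition whp (R : realType) (p : R)
    (P : forall n : nat, {set 'I_n * 'I_n} -> bool) : Prop :=
  forall eps : R, 0 < eps -> exists N : nat, forall n : nat, (N <= n)%N ->
    1 - eps <= gnp_prob p (P n).

Definition logb (R : realType) (b x : R) : R := ln x / ln b.

Definition twoK2 : rel 'I_4 :=
  fun x y => [|| ((x == 0 :> nat) && (y == 1 :> nat)), ((x == 1 :> nat) && (y == 0 :> nat)),
                 ((x == 2 :> nat) && (y == 3 :> nat)) | ((x == 3 :> nat) && (y == 2 :> nat))].

(* Main.v *)
Require Import Defs.
From HB Require Import structures.
From mathcomp Require Import all_boot all_order all_algebra all_fingroup.
From mathcomp Require Import reals sequences exp.
From mathcomp Require Import ring lra zify.
Import Order.TTheory GRing.Theory Num.Theory.
Local Open Scope ring_scope.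
Set Implicit Arguments.
Unset Strict Implicit.
Unset Printing Implicit Defensive.

(* Lower bounds. Put k = k1(H) and cut the colour classes greedily into m
   disjoint monochromatic k-sets ("rows"), leaving at most k - 1 vertices per
   class, so that n <= chi (k - 1) + k m. A suitable bipartite pattern between
   two rows yields an edge, hence two different classes, and an induced copy of
   H inside their union; so no two rows carry the pattern. For fixed rows the
   C(m, 2) pattern events are independent, so this has probability
   q ^ C(m, 2) with q < 1, and the union bound over the at most n ^ (k m)
   families of rows forces m = O(log n). For 2K_2 both perfect matchings between
   two pairs are patterns, so q = Q, and since reordering the rows preserves
   avoidance the union bound gains a factor m!, which gives the log log term.

   Upper bounds. A colouring with classes of size < k1 avoids H. The
   lower-bound argument for the empty pattern shows that among O(log n) disjoint
   independent r-sets two merge into an independent 2r-set; hence every set of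
   C log n vertices contains an independent set of size k1 - 1, and almost all
   vertices can be split into such sets. If k2 >= 2, one independent class
   together with singletons avoids H, and the second moment method provides an
   independent set of size 2 log_d n - O(log log n): with this slack the l-th
   overlap term of Var X / (E X)^2 is at most x ^ l for some x = O(1 / log n). *)

(** * Random subsets *)

(* Expectation of [f] over the random subset of [U] containing each element
   independently with probability [p]. *)
Definition bern (R : realType) (p : R) (T : finType) (U : {set T})
    (f : {set T} -> R) : R :=
  \sum_(E : {set T} | E \subset U)
     p ^+ #|E| * (1 - p) ^+ (#|U| - #|E|)%N * f E.

Section Bernoulli.
Context {R : realType} {p : R} {T : finType}.
Implicit Types (U B F E : {set T}) (f g : {set T} -> R).

Lemma eq_bern U f g :
  (forall E, E \subset U -> f E = g E) -> bern p U f = bern p U g.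
Proof. by move=> fg; apply: eq_bigr => E sEU; rewrite fg. Qed.

Lemma bern_sum U (I : finType) (P : pred I) (F : I -> {set T} -> R) :
  bern p U (fun E => \sum_(i | P i) F i E) = \sum_(i | P i) bern p U (F i).
Proof. by rewrite exchange_big; apply: eq_bigr => E _; rewrite mulr_sumr. Qed.

Lemma bernZ U (c : R) f : bern p U (fun E => c * f E) = c * bern p U f.
Proof. by rewrite mulr_sumr; apply: eq_bigr => E _; rewrite mulrCA. Qed.

Lemma bernD U f g : bern p U (fun E => f E + g E) = bern p U f + bern p U g.
Proof. by rewrite -big_split; apply: eq_bigr => E _; rewrite mulrDr. Qed.

Lemma bern_split U B f : B \subset U ->
  bern p U f = bern p B (fun E1 => bern p (U :\: B) (fun E2 => f (E1 :|: E2))).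
Proof.
move=> sBU; rewrite /bern.
under [RHS]eq_bigr do rewrite mulr_sumr.
rewrite pair_big /=.
rewrite (reindex_onto (fun q : {set T} * {set T} => q.1 :|: q.2)
   (fun E => (E :&: B, E :\: B))) /=; last first.
  by move=> E _; rewrite setID.
apply: eq_big => [[E1 E2] /=|[E1 E2] /=].
  rewrite subUset subsetD xpair_eqE.
  apply/idP/idP.
    move=> /andP[/andP[sE1 sE2] /andP[/eqP e1 /eqP e2]].
    rewrite sE2 -{1}e1 subsetIr /=.
    by rewrite -e2 disjoints_subset setDE subsetIr.
  move=> /andP[s1 /andP[s2 d2]].
  rewrite (subset_trans s1) // s2 /= setIUl setDUl.
  rewrite (setIidPl s1) (disjoint_setI0 d2) setU0 eqxx /=.
  by rewrite (setDidPl d2); move: s1; rewrite -setD_eq0 => /eqP->; rewrite set0U.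
move=> /andP[]; rewrite subUset => /andP[s1 s2] /eqP[e1 e2].
have sE1 : E1 \subset B by rewrite -e1 subsetIr.
have d12 : [disjoint E1 & E2].
  by rewrite disjoint_sym (disjointWr sE1) // -e2 disjoints_subset setDE subsetIr.
have sE2 : E2 \subset U :\: B by rewrite -e2 setSD // subUset s1.
have := leq_card_setU E1 E2; rewrite d12 => -[_ /eqP ->].
have cU : #|U| = (#|B| + #|U :\: B|)%N.
  by rewrite -(cardsID B U) (setIidPr sBU).
have c1 := subset_leq_card sE1; have c2 := subset_leq_card sE2.
rewrite cU exprD.
have -> : (#|B| + #|U :\: B| - (#|E1| + #|E2|) =
   (#|B| - #|E1|) + (#|U :\: B| - #|E2|))%N by lia.
by rewrite exprD; ring.
Qed.

Lemma bern_set0 f : bern p set0 f = f set0.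
Proof.
rewrite /bern (eq_bigl (pred1 set0)) => [|E]; last by rewrite subset0.
by rewrite big_pred1_eq cards0 mulr1 mul1r.
Qed.

Lemma bern_set1 x f : bern p [set x] f = p * f [set x] + (1 - p) * f set0.
Proof.
have ne : [set x] != set0 by apply/set0Pn; exists x; rewrite inE.
rewrite /bern (bigD1 [set x]) ?subxx //= cards1 expr1 subnn mulr1.
rewrite (bigD1 set0) ?sub0set ?(eq_sym set0) //= cards0 expr0 mul1r subn0 expr1.
rewrite big1 ?addr0 // => E /andP[/andP[]].
by rewrite subset1 => /orP[]/eqP->; rewrite eqxx.
Qed.

Lemma bern_cst U (c : R) : bern p U (fun=> c) = c.
Proof.
move: {2}#|U| (erefl #|U|) => m; elim: m U => [|m IH] U cU.
  by move/eqP: cU; rewrite cards_eq0 => /eqP->; rewrite bern_set0.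
have /set0Pn[x xU] : U != set0 by rewrite -card_gt0 cU.
rewrite (bern_split (B := [set x])) ?sub1set // bern_set1 IH; last first.
  by move: cU; rewrite (cardsD1 x) xU => -[].
ring.
Qed.

Lemma bern_indep U B f g : B \subset U ->
  bern p U (fun E => f (E :&: B) * g (E :\: B)) =
  bern p B f * bern p (U :\: B) g.
Proof.
move=> sBU; rewrite (bern_split _ sBU) mulrC -bernZ.
apply: eq_bern => E1 s1; rewrite mulrC -bernZ; apply: eq_bern => E2.
rewrite subsetD => /andP[s2 d2]; congr (f _ * g _).
  by rewrite setIUl (setIidPl s1) (disjoint_setI0 d2) setU0.
rewrite setDUl (setDidPl d2).
by move: s1; rewrite -setD_eq0 => /eqP->; rewrite set0U.
Qed.

Lemma bern_restrict U B f : B \subset U ->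
  bern p U (fun E => f (E :&: B)) = bern p B f.
Proof.
move=> sBU; have := bern_indep f (fun=> 1) sBU.
by rewrite bern_cst mulr1 => <-; apply: eq_bern => E _; rewrite mulr1.
Qed.

Lemma bern_avoid U F : F \subset U ->
  bern p U (fun E => (E :&: F == set0)%:R) = (1 - p) ^+ #|F|.
Proof.
move=> sFU; rewrite (bern_restrict (fun E => (E == set0)%:R) sFU) /bern.
rewrite (bigD1 set0) ?sub0set //= cards0 eqxx subn0 mul1r mulr1.
by rewrite big1 ?addr0 // => E /andP[_ /negbTE->]; rewrite mulr0.
Qed.

Hypothesis p01 : 0 <= p <= 1.

Lemma bern_weight_ge0 U E : 0 <= p ^+ #|E| * (1 - p) ^+ (#|U| - #|E|)%N.
Proof.
by case/andP: p01 => *; rewrite mulr_ge0 // exprn_ge0 // subr_ge0.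
Qed.

Lemma ler_bern U f g :
  (forall E, E \subset U -> f E <= g E) -> bern p U f <= bern p U g.
Proof.
by move=> fg; apply: ler_sum => E sE; rewrite ler_wpM2l ?bern_weight_ge0 ?fg.
Qed.

Lemma second_moment U f (m : R) : 0 < m -> bern p U f = m ->
  bern p U (fun E => (f E == 0)%:R) <=
  (bern p U (fun E => f E ^+ 2) - m ^+ 2) / m ^+ 2.
Proof.
move=> m0 fm; rewrite ler_pdivlMr ?exprn_gt0 // mulrC -bernZ.
have -> : bern p U (fun E => f E ^+ 2) - m ^+ 2 =
          bern p U (fun E => (f E - m) ^+ 2).
  rewrite [RHS](eq_bern (g := fun E => f E ^+ 2 + ((- 2 * m) * f E + m ^+ 2)));
    last by move=> E _; ring.
  by rewrite !bernD bernZ fm bern_cst; ring.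
apply: ler_bern => E _; case: eqP => [->|_]; last by rewrite mulr0 sqr_ge0.
by rewrite sub0r sqrrN mulr1.
Qed.

End Bernoulli.

Lemma bern_imset (R : realType) (p : R) (T T' : finType) (h : T -> T')
    (D : {set T}) (f : {set T'} -> R) : {in D &, injective h} ->
  bern p (h @: D) f = bern p D (fun E => f (h @: E)).
Proof.
move=> injh; rewrite /bern.
rewrite (reindex_onto (fun E : {set T} => h @: E)
    (fun E' : {set T'} => [set x in D | h x \in E'])) /=; last first.
  move=> E' sE'; apply/setP => y; apply/imsetP/idP.
    by case=> x; rewrite inE => /andP[_ hx] ->.
  move=> yE'; have /imsetP[x xD yx] := subsetP sE' _ yE'.
  by exists x => //; rewrite inE xD -yx.
apply: eq_big => [E|E].
  apply/andP/idP => [[_ /eqP <-]|sED].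
    by apply/subsetP => x; rewrite inE => /andP[].
  split; first exact: imsetS.
  apply/eqP/setP => x; rewrite inE; apply/andP/idP => [[xD]|xE].
    by case/imsetP => y yE /injh-> //; apply: (subsetP sED).
  by split; [apply: (subsetP sED)|apply: imset_f].
move=> /andP[_ /eqP eE].
have sED : E \subset D by rewrite -eE; apply/subsetP => x; rewrite inE => /andP[].
rewrite !card_in_imset // => x y xE yE; apply: injh; exact: (subsetP sED).
Qed.

Lemma bern_setX (R : realType) (p : R) (I T : finType) (P : {set I})
    (f : {set T} -> R) :
  bern p (setX P [set: T])
    (fun E => \prod_(i in P) f [set t | (i, t) \in E]) =
  bern p [set: T] f ^+ #|P|.
Proof.
move: {2}#|P| (erefl #|P|) => m; elim: m P => [|m IH] P cP.
  rewrite cP expr0; move/eqP: cP; rewrite cards_eq0 => /eqP->.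
  by rewrite (eq_bern (g := fun=> 1)) ?bern_cst // => E _; rewrite big_set0.
have /set0Pn[i iP] : P != set0 by rewrite -card_gt0 cP.
have cP' : #|P :\ i| = m by move: cP; rewrite (cardsD1 i) iP => -[].
pose B := [set (i, t) | t in [set: T]].
have mB j t : ((j, t) \in B) = (j == i).
  by apply/imsetP/eqP => [[u _ []]//|->]; exists t.
have sB : B \subset setX P [set: T].
  by apply/subsetP => -[j t]; rewrite mB !inE /= => /eqP->; rewrite iP.
pose F (E : {set I * T}) := f [set t | (i, t) \in E].
pose G (E : {set I * T}) := \prod_(j in P :\ i) f [set t | (j, t) \in E].
rewrite (eq_bern (g := fun E => F (E :&: B) * G (E :\: B))); last first.
  move=> E _; rewrite (bigD1 i) //=; congr (_ * _).
    by congr f; apply/setP => t; rewrite !inE mB eqxx andbT.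
  apply: eq_big => [j|j /andP[_ ji]]; first by rewrite !inE andbC.
  by congr f; apply/setP => t; rewrite !inE mB (negbTE ji).
rewrite bern_indep // bern_imset; last by move=> x y _ _ [].
rewrite (_ : setX P [set: T] :\: B = setX (P :\ i) [set: T]); last first.
  by apply/setP => -[j t]; rewrite !inE mB /= !andbT.
rewrite IH // cP' cP exprS; congr (_ * _); apply: eq_bern => E _.
congr f; apply/setP => t; rewrite inE; apply/imsetP/idP => [[u uE []->]//|tE].
by exists t.
Qed.

(** * Patterns between rows *)

Definition inner_pairs (n : nat) (S : {set 'I_n}) : {set 'I_n * 'I_n} :=
  [set xy in upairs n | (xy.1 \in S) && (xy.2 \in S)].

Lemma inner_pairs_sub n (S : {set 'I_n}) : inner_pairs S \subset upairs n.
Proof. by apply/subsetP => xy; rewrite inE => /andP[]. Qed.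

Lemma inner_pairsI n (S T : {set 'I_n}) :
  inner_pairs S :&: inner_pairs T = inner_pairs (S :&: T).
Proof.
apply/setP => xy; rewrite !inE.
by case: (xy.1 < xy.2)%N => //=; rewrite andbACA.
Qed.

Lemma card_inner_pairs n (S : {set 'I_n}) : #|inner_pairs S| = 'C(#|S|, 2).
Proof.
rewrite -cards_draws.
rewrite -(card_in_imset (f := fun xy : 'I_n * 'I_n => [set xy.1; xy.2])).
  apply: eq_card => A; rewrite [in RHS]inE; apply/imsetP/andP.
    case=> -[x y]; rewrite !inE /= => /and3P[xy xS yS] ->; split.
      by rewrite subUset !sub1set xS.
    by rewrite cards2 neq_ltn xy.
  case=> sAS /cards2P[x [y [xy eA]]]; move: sAS xy.
  rewrite {A}eA subUset !sub1set neq_ltn => /andP[xS yS] /orP[xy|yx].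
    by exists (x, y); rewrite ?inE /= ?xy ?xS.
  by exists (y, x); rewrite ?inE /= ?yx ?xS ?yS // setUC.
move=> [x y] [u v]; rewrite !inE /= => /and3P[xy _ _] /and3P[uv _ _] /setP e.
have : x \in [set u; v] by rewrite -e !inE eqxx.
have : y \in [set u; v] by rewrite -e !inE eqxx orbT.
rewrite !inE => /orP[]/eqP ey /orP[]/eqP ex; rewrite ex ey // in xy *.
- by rewrite ltnn in xy.
- by have := ltn_trans xy uv; rewrite ltnn.
- by rewrite ltnn in xy.
Qed.

Lemma inner_pairsT n : inner_pairs [set: 'I_n] = upairs n.
Proof. by apply/setP => xy; rewrite !inE !andbT. Qed.

Lemma card_upairs n : #|upairs n| = 'C(n, 2).
Proof. by rewrite -inner_pairsT card_inner_pairs cardsT card_ord. Qed.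

Definition edge (n : nat) (x y : 'I_n) : 'I_n * 'I_n :=
  if (x < y)%N then (x, y) else (y, x).

Lemma edge_upairs n (x y : 'I_n) : x != y -> edge x y \in upairs n.
Proof. by rewrite neq_ltn /edge; case: ltnP => //=; rewrite inE. Qed.

Lemma gadj_edge n (E : {set 'I_n * 'I_n}) x y : E \subset upairs n ->
  gadj E x y = (x != y) && (edge x y \in E).
Proof.
move=> /subsetP sE; rewrite /gadj /edge.
have nE (u v : 'I_n) : (v <= u)%N -> (u, v) \in E = false.
  by move=> uv; apply/negP => /sE; rewrite inE /= ltnNge uv.
have [->|] := eqVneq x y; first by rewrite !nE.
move=> _; case: ltnP => [xy|yx] /=; first by rewrite (nE y x (ltnW xy)) orbF.
by rewrite (nE x y yx).
Qed.

Lemma gadj_sym n (E : {set 'I_n * 'I_n}) : symmetric (gadj E).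
Proof. by move=> x y; rewrite /gadj orbC. Qed.

Lemma edge_inj n (x y u v : 'I_n) : edge x y = edge u v ->
  (x = u /\ y = v) \/ (x = v /\ y = u).
Proof. by rewrite /edge; case: ifP; case: ifP => _ _ [-> ->]; auto. Qed.

Section Patterns.
Context {n m k : nat}.
Implicit Types (E : {set 'I_n * 'I_n}) (g : 'I_m * 'I_k -> 'I_n).

Definition cross E g (i j : 'I_m) : {set 'I_k * 'I_k} :=
  [set ab : 'I_k * 'I_k | gadj E (g (i, ab.1)) (g (j, ab.2))].

Definition avoids (Pat : pred {set 'I_k * 'I_k}) E g : bool :=
  [forall i : 'I_m, forall j : 'I_m, (i < j)%N ==> ~~ Pat (cross E g i j)].

Lemma prob_avoids (R : realType) (p : R) (Pat : pred {set 'I_k * 'I_k}) g :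
  injective g ->
  gnp_prob p (fun E => avoids Pat E g) =
  bern p [set: 'I_k * 'I_k] (fun M => (~~ Pat M)%:R) ^+ 'C(m, 2).
Proof.
move=> injg; pose D := setX (upairs m) [set: 'I_k * 'I_k].
pose h (q : ('I_m * 'I_m) * ('I_k * 'I_k)) :=
  edge (g (q.1.1, q.2.1)) (g (q.1.2, q.2.2)).
have neD q : q \in D -> g (q.1.1, q.2.1) != g (q.1.2, q.2.2).
  case: q => [[i j] [a b]]; rewrite !inE /= andbT => ij.
  by apply/eqP => /injg[e _]; move: ij; rewrite e ltnn.
have injh : {in D &, injective h}.
  move=> [[i j] [a b]] [[i' j'] [a' b']]; rewrite !inE /= !andbT => ij ij'.
  move/edge_inj => /= [[/injg[-> ->] /injg[-> ->]]//|[/injg[e _] /injg[e' _]]].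
  by move: ij; rewrite e e' ltnNge ltnW.
have sD : h @: D \subset upairs n.
  by apply/subsetP => _ /imsetP[q qD ->]; rewrite edge_upairs // neD.
pose F (E : {set 'I_n * 'I_n}) : R := \prod_(ij in upairs m)
  (~~ Pat [set ab | h (ij, ab) \in E])%:R.
transitivity (bern p (upairs n) (fun E => F (E :&: h @: D))).
  apply: eq_bern => E sE; rewrite /F.
  transitivity (\prod_(ij in upairs m) (~~ Pat (cross E g ij.1 ij.2))%:R : R).
    case: (boolP (avoids Pat E g)) => [/forallP H|/forallPn[i /forallPn[j]]].
      rewrite big1 // => -[i j]; rewrite inE => ij /=.
      by have /forallP/(_ j) := H i; rewrite ij /= => ->.
    rewrite negb_imply => /andP[ij]; rewrite negbK => Pij.
    by rewrite (bigD1 (i, j)) ?inE //= Pij mul0r.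
  apply: eq_bigr => -[i j] ij; congr (~~ Pat _)%:R; apply/setP => ab.
  have qD : ((i, j), ab) \in D by rewrite inE /= ij inE.
  by rewrite !inE gadj_edge // (neD _ qD) imset_f // andbT.
rewrite bern_restrict // bern_imset // -card_upairs -bern_setX.
apply: eq_bern => E sE; apply: eq_bigr => ij ijm.
congr (~~ Pat _)%:R; apply/setP => ab; rewrite !inE.
apply/imsetP/idP => [[q qE]|]; last by exists (ij, ab).
move/injh => ->//; last exact: (subsetP sE).
by rewrite inE ijm inE.
Qed.

Lemma prob_exists_avoids (R : realType) (p : R) (Pat : pred {set 'I_k * 'I_k}) s :
  0 <= p <= 1 ->
  (forall E g, injective g -> avoids Pat E g ->
     (s <= #|[set g : {ffun 'I_m * 'I_k -> 'I_n} |
             injectiveb g && avoids Pat E g]|)%N) ->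
  gnp_prob p (fun E => [exists g : {ffun 'I_m * 'I_k -> 'I_n},
                          injectiveb g && avoids Pat E g]) * s%:R <=
  n%:R ^+ (m * k) *
  bern p [set: 'I_k * 'I_k] (fun M => (~~ Pat M)%:R) ^+ 'C(m, 2).
Proof.
move=> p01 Hs; set B := bern _ _ _.
have B0 : 0 <= B.
  by apply: sumr_ge0 => E _; rewrite mulr_ge0 ?bern_weight_ge0.
have -> : n%:R ^+ (m * k) * B ^+ 'C(m, 2) =
    \sum_(g : {ffun 'I_m * 'I_k -> 'I_n}) B ^+ 'C(m, 2).
  by rewrite sumr_const card_ffun card_prod !card_ord -[RHS]mulr_natl natrX.
apply: (@le_trans _ _ (\sum_(g : {ffun 'I_m * 'I_k -> 'I_n} | injectiveb g)
    gnp_prob p (fun E => avoids Pat E g))); last first.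
  rewrite [leRHS](bigID (fun g : {ffun _} => injectiveb g)) /=.
  rewrite ler_wpDr ?sumr_ge0 // => [i _|]; first exact: exprn_ge0.
  by apply: ler_sum => g /injectiveP injg; rewrite prob_avoids.
rewrite -[leRHS]bern_sum mulrC -bernZ.
apply: ler_bern => // E sE.
case: existsP => [[g /andP[/injectiveP injg ag]]|_]; last first.
  by rewrite mulr0 sumr_ge0.
rewrite mulr1 -natr_sum ler_nat (leq_trans (Hs _ _ injg ag)) //.
rewrite -sum1_card big_mkcond [leqRHS]big_mkcond /=; apply: leq_sum => f _.
by rewrite inE; case: (injectiveb f) => //=; case: (avoids _ _ _).
Qed.

End Patterns.

(** * Colourings *)

Lemma set_ord_injection (T : finType) (A : {set T}) r : (r <= #|A|)%N ->
  exists f : 'I_r -> T, injective f /\ forall a, f a \in A.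
Proof.
move=> rA; exists (fun a => enum_val (widen_ord rA a)); split.
  by move=> a b /enum_val_inj /(congr1 val) /= /val_inj.
by move=> a; apply: enum_valP.
Qed.

Lemma greedy_rows n r u m (Phi : ('I_r -> 'I_n) -> Prop) (W : {set 'I_n}) :
  (forall U : {set 'I_n}, U \subset W -> (u <= #|U|)%N ->
     exists f : 'I_r -> 'I_n,
       [/\ injective f, forall a, f a \in U & Phi f]) ->
  (u + r * m <= #|W| + r)%N ->
  exists g : 'I_m * 'I_r -> 'I_n,
    [/\ injective g, forall q, g q \in W & forall i, Phi (fun a => g (i, a))].
Proof.
move=> ext; elim: m => [|m IH] um.
  have no : 'I_0 -> False by case.
  by exists (fun q => match no q.1 with end); split=> [[[]]|[[]]|[]].
have [|g [injg gW gPhi]] := IH; first by move: um; rewrite mulnS; lia.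
pose X : {set 'I_n} := g @: [set: 'I_m * 'I_r].
have cX : #|X| = (m * r)%N by rewrite card_imset // cardsT card_prod !card_ord.
have [||f [injf fU fPhi]] := ext (W :\: X).
- exact: subsetDl.
- have := cardsID X W; have := subset_leq_card (subsetIr W X).
  by move: um; rewrite cX mulnS [(r * m)%N]mulnC; lia.
have fg a q : f a <> g q.
  by move=> e; have := fU a; rewrite inE e imset_f ?inE.
pose G (q : 'I_m.+1 * 'I_r) :=
  if unlift ord_max q.1 is Some i then g (i, q.2) else f q.2.
exists G; split; rewrite /G.
- move=> [i a] [j b] /=.
  case: unliftP => [i'|] ->; case: unliftP => [j'|] ->.
  + by move/injg => [-> ->].
  + by move/esym/fg.
  + by move/fg.
  + by move/injf => ->.
- move=> [i a] /=; case: unliftP => [i'|] _; first exact: gW.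
  by have := fU a; rewrite inE => /andP[].
- by move=> i /=; case: unliftP => [i'|] _; [apply: gPhi|apply: fPhi].
Qed.

Lemma mono_rows n k r m (c : 'I_n -> 'I_k) :
  (k * r.-1 + 1 + r * m <= n + r)%N ->
  exists g : 'I_m * 'I_r -> 'I_n,
    injective g /\ forall i a b, c (g (i, a)) = c (g (i, b)).
Proof.
move=> kn; have [||g [injg _ gm]] := @greedy_rows n r (k * r.-1 + 1) m
    (fun f => forall a b, c (f a) = c (f b)) [set: 'I_n].
- move=> U _ kU.
  have [i ri] : exists i : 'I_k, (r <= #|[set x in U | c x == i]|)%N.
    apply/existsP; rewrite -[X in is_true X]negbK negb_exists; apply/negP.
    move=> /forallP small; suff: (#|U| <= k * r.-1)%N by lia.
    rewrite -sum1_card (partition_big c predT) //=.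
    rewrite -[X in (_ <= X * _)%N]card_ord -sum_nat_const; apply: leq_sum => i _.
    have := small i; rewrite -ltnNge -sum1_card.
    rewrite (eq_bigl (fun x => (x \in U) && (c x == i))) => [|x]; last by rewrite inE.
    by case: r {kn kU small} => //= r.
  have [f [injf fU]] := set_ord_injection ri; exists f; split=> // a.
    by have := fU a; rewrite inE => /andP[].
  move=> b; have := fU a; have := fU b; rewrite !inE.
  by move=> /andP[_ /eqP->] /andP[_ /eqP->].
- by rewrite cardsT card_ord.
- by exists g.
Qed.

Lemma bigminn_le (I : eqType) (s : seq I) (P : pred I) (F : I -> nat) x i :
  i \in s -> P i -> (\big[minn/x]_(j <- s | P j) F j <= F i)%N.
Proof.
elim: s => // j s IH; rewrite inE big_cons => /orP[/eqP<-|js] Pi.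
  by rewrite Pi geq_minl.
by case: ifP => _; rewrite ?geq_min IH ?orbT.
Qed.

Section ChiH.
Context {V : finType} {e : rel V}.

Lemma chiH_le n (E : {set 'I_n * 'I_n}) k (c : {ffun 'I_n -> 'I_k}) :
  (k <= n)%N -> H_avoiding e E c -> (chiH e E <= k)%N.
Proof.
move=> kn avc; rewrite leqNgt; apply/negP => /(before_find 0%N).
rewrite nth_iota ?ltnS // add0n => /negbT/existsPn/(_ c); by rewrite avc.
Qed.

Lemma chiH_colouring n (E : {set 'I_n * 'I_n}) : (chiH e E <= n)%N ->
  exists c : {ffun 'I_n -> 'I_(chiH e E)}, H_avoiding e E c.
Proof.
move=> le_n; apply/existsP.
pose a k := [exists c : {ffun 'I_n -> 'I_k}, H_avoiding e E c].
have ha : has a (iota 0 n.+1) by rewrite has_find size_iota ltnS.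
by have := nth_find 0%N ha; rewrite nth_iota ?ltnS.
Qed.

Lemma k1_le A : bipartition e A -> (k1 e <= maxn #|A| #|~: A|)%N.
Proof. by move=> bA; apply: (bigminn_le _ _ (mem_index_enum A)). Qed.

Lemma k2_le A : bipartition e A -> (k2 e <= minn #|A| #|~: A|)%N.
Proof. by move=> bA; apply: (bigminn_le _ _ (mem_index_enum A)). Qed.

Lemma k1_attained : bipartite e ->
  exists2 A, bipartition e A & (maxn #|A| #|~: A| <= k1 e)%N.
Proof.
case=> A0 bA0.
suff [->|[A bA ->]] : k1 e = #|V| \/
    exists2 A, bipartition e A & k1 e = maxn #|A| #|~: A|.
- by exists A0 => //; rewrite geq_max !max_card.
- by exists A.
apply: (big_ind (fun x => x = #|V| \/
    exists2 A, bipartition e A & x = maxn #|A| #|~: A|)) => [|x y Hx Hy|A bA].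
- by left.
- by rewrite /minn; case: ifP.
- by right; exists A.
Qed.

Lemma proper_col_neq n k (E : {set 'I_n * 'I_n}) (c : {ffun 'I_n -> 'I_k}) x y :
  proper_col E c -> gadj E x y -> c x != c y.
Proof. by move=> /forallP/(_ x)/forallP/(_ y)/implyP. Qed.

Lemma chiH_le_rep n (E : {set 'I_n * 'I_n}) (rep : 'I_n -> 'I_n) :
  (forall x y, gadj E x y -> rep x != rep y) ->
  (forall i j A, i != j -> bipartition e A ->
     (#|A| <= #|[set x | rep x == i]|)%N ->
     (#|~: A| <= #|[set x | rep x == j]|)%N -> False) ->
  (chiH e E <= #|rep @: [set: 'I_n]|)%N.
Proof.
move=> prop small.
pose S := rep @: [set: 'I_n].
have kn : (#|S| <= n)%N.
  by rewrite (leq_trans (leq_imset_card _ _)) // cardsT card_ord.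
have repS x : rep x \in S by exact: imset_f.
pose c : {ffun 'I_n -> 'I_#|S|} := [ffun x => enum_rank_in (repS x) (rep x)].
have cK x : enum_val (c x) = rep x by rewrite ffunE enum_rankK_in.
have cE x y : gadj E x y -> c x != c y.
  by move=> /prop; apply: contraNneq => cxy; rewrite -!cK cxy.
apply: (chiH_le kn (c := c)); apply/andP; split.
  by do 2!apply/forallP => ?; apply/implyP => /cE.
apply/forallP => i; apply/forallP => j; apply/implyP => ij.
apply/existsP => -[f /and3P[/injectiveP injf /forallP fij /forallP fE]].
have eE v w : e v w = gadj E (f v) (f w) by have /forallP/(_ w)/eqP := fE v.
pose A := [set v | c (f v) == i].
have Aj v : v \in ~: A -> c (f v) = j.
  by rewrite !inE => /negbTE ni; have := fij v; rewrite ni => /eqP.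
have Ai v : v \in A -> c (f v) = i by rewrite inE => /eqP.
apply: (small (enum_val i) (enum_val j) A).
- by apply: contraNneq ij => /enum_val_inj->.
- apply/andP; split; apply/forall_inP => v vA; apply/forall_inP => w wA;
    rewrite eE; apply/negP => /cE/eqP; [rewrite !Ai | rewrite !Aj]; done.
- rewrite -(card_imset _ injf); apply/subset_leq_card/subsetP.
  by move=> _ /imsetP[v vA ->]; rewrite inE -cK Ai.
- rewrite -(card_imset _ injf); apply/subset_leq_card/subsetP.
  by move=> _ /imsetP[v vA ->]; rewrite inE -cK Aj.
Qed.

Section Rows.
Context {n t r : nat} {E : {set 'I_n * 'I_n}} {g : 'I_t * 'I_r.+1 -> 'I_n}.
Hypothesis injg : injective g.
Hypothesis row_indep : forall i a b, ~~ gadj E (g (i, a)) (g (i, b)).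

Definition row_rep (x : 'I_n) : 'I_n :=
  if [pick q | g q == x] is Some q then g (q.1, ord0) else x.

Lemma row_rep_row i a : row_rep (g (i, a)) = g (i, ord0).
Proof.
rewrite /row_rep; case: pickP => [q /eqP/injg->//|/(_ (i, a))].
by rewrite eqxx.
Qed.

Lemma row_repP x : row_rep x = x \/
  exists i a, x = g (i, a) /\ row_rep x = g (i, ord0).
Proof.
rewrite /row_rep; case: pickP => [[i a] /eqP <-|_]; last by left.
by right; exists i, a.
Qed.

Lemma row_rep_class x y : row_rep x = row_rep y -> x = y \/
  exists i a b, x = g (i, a) /\ y = g (i, b).
Proof.
case: (row_repP x) => [ex|[i [a [-> _]]]].
  case: (row_repP y) => [ey|[j [b [-> _]]]]; first by rewrite ex ey; left.
  by rewrite ex row_rep_row => ->; right; exists j, ord0, b.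
rewrite row_rep_row; case: (row_repP y) => [ey|[j [b [-> _]]]].
  by rewrite ey => <-; right; exists i, a, ord0.
by rewrite row_rep_row => /injg[->]; right; exists j, a, b.
Qed.

Lemma row_rep_proper x y : irreflexive (gadj E) -> gadj E x y ->
  row_rep x != row_rep y.
Proof.
move=> irr; apply: contraTneq => /row_rep_class[->|[i [a [b [-> ->]]]]] //.
by rewrite irr.
Qed.

Lemma card_row_rep : (#|row_rep @: [set: 'I_n]| <= n - t * r)%N.
Proof.
pose B := g @: setX [set: 'I_t] [set~ ord0].
have cB : #|B| = (t * r)%N.
  by rewrite card_imset // cardsX cardsT card_ord cardsC1 card_ord.
suff sB : row_rep @: [set: 'I_n] \subset ~: B.
  have := subset_leq_card sB; have := cardsC B; rewrite card_ord; lia.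
apply/subsetP => _ /imsetP[x _ ->]; rewrite inE; apply/imsetP => -[[i a]].
rewrite !inE /= => a0 ea.
case: (row_repP x) => [ex|[j [b [_ eb]]]].
  move: ea a0; rewrite ex => e1; move: ex; rewrite e1 row_rep_row => /injg[<-].
  by rewrite eqxx.
by move: ea a0; rewrite eb => /injg[_ <-]; rewrite eqxx.
Qed.

Lemma card_row_rep_class i : (#|[set x | row_rep x == i]| <= r.+1)%N.
Proof.
case: (set_0Vmem [set x | row_rep x == i]) => [->|[x]]; first by rewrite cards0.
rewrite inE => /eqP xi.
have same y : y \in [set y | row_rep y == i] -> row_rep y = row_rep x.
  by rewrite inE xi => /eqP.
have [[j a] /eqP gx|nox] := pickP (fun q => g q == x); last first.
  rewrite (_ : [set y | _] = [set x]) ?cards1 //; apply/setP => y; rewrite [RHS]inE.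
  apply/idP/eqP => [/same/row_rep_class[//|[j [a [b [_ eb]]]]]|->].
    by have := nox (j, b); rewrite eb eqxx.
  by rewrite inE xi.
rewrite -(card_ord r.+1) -cardsT.
apply: leq_trans (leq_imset_card (fun a => g (j, a)) _).
apply/subset_leq_card/subsetP => y /same/row_rep_class[->|[j' [c [b [-> eb]]]]].
  by rewrite -gx imset_f ?inE.
by move: gx; rewrite eb => /injg[-> _]; apply: imset_f; rewrite inE.
Qed.

Lemma chiH_le_rows : irreflexive (gadj E) -> (r.+1 < k1 e)%N ->
  (chiH e E <= n - t * r)%N.
Proof.
move=> irr rk; apply: leq_trans card_row_rep.
apply: chiH_le_rep => [x y|i j A _ bA ci cj]; first exact: row_rep_proper.
have := k1_le bA; rewrite leqNgt => /negP[].
apply: leq_trans rk; rewrite ltnS geq_max.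
by rewrite (leq_trans ci) ?(leq_trans cj) ?card_row_rep_class.
Qed.

Lemma chiH_le_one_row : t = 1%N -> irreflexive (gadj E) -> (1 < k2 e)%N ->
  (chiH e E <= n - r)%N.
Proof.
move=> t1 irr k22; apply: (@leq_trans (n - t * r)); last by rewrite t1 mul1n.
apply: leq_trans card_row_rep.
apply: chiH_le_rep => [x y|i j A ij bA ci cj]; first exact: row_rep_proper.
have sing l : (1 < #|[set x | row_rep x == l]|)%N -> exists s, l = g (s, ord0).
  move=> /card_gt1P[x [y []]]; rewrite !inE => /eqP <- /eqP/esym yl /eqP xy.
  case/row_rep_class: yl => // -[s [a [b [-> _]]]].
  by exists s; rewrite row_rep_row.
have := leq_trans k22 (k2_le bA); rewrite leq_min => /andP[A1 B1].
have [s ei] := sing i (leq_trans A1 ci).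
have [s' ej] := sing j (leq_trans B1 cj).
move/eqP: ij; apply; rewrite ei ej; congr (g (_, _)).
apply: val_inj; case: s s' {ei ej} => [s +] [s' +] /=; rewrite t1.
by case: s s' => [|?] [|?].
Qed.

End Rows.

End ChiH.

Section HPattern.
Context {V : finType} {e : rel V}.
Hypothesis simple_e : simple_graph e.

(* The pattern contains an edge, so two rows realising it have different
   colours, and the copy of [H] lies in the union of two colour classes. *)
Lemma pattern_avoided r (A : {set V}) (a b : V -> 'I_r) (M : {set 'I_r * 'I_r})
    n k (E : {set 'I_n * 'I_n}) (c : {ffun 'I_n -> 'I_k})
    m (g : 'I_m * 'I_r -> 'I_n) (i j : 'I_m) :
  bipartition e A -> {in A &, injective a} -> {in ~: A &, injective b} ->
  (forall u w, u \in A -> w \in ~: A -> ((a u, b w) \in M) = e u w) ->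
  (exists2 u, u \in A & exists2 w, w \in ~: A & e u w) ->
  H_avoiding e E c -> injective g ->
  (forall i a b, c (g (i, a)) = c (g (i, b))) -> i != j -> cross E g i j != M.
Proof.
move=> /andP[/forall_inP iA /forall_inP iB] inja injb Me [u0 u0A [w0 w0B e0]].
move=> /andP[prop /forallP av] injg mono ij; apply/eqP => crossM.
have iAe u v : u \in A -> v \in A -> e u v = false.
  by move=> /iA/forall_inP H /H /negbTE.
have iBe u v : u \in ~: A -> v \in ~: A -> e u v = false.
  by move=> /iB/forall_inP H /H /negbTE.
have adj u w : u \in A -> w \in ~: A ->
    gadj E (g (i, a u)) (g (j, b w)) = e u w.
  by move=> uA wB; rewrite -Me // -crossM inE.
have row_adj l x y : gadj E (g (l, x)) (g (l, y)) = false.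
  by apply/negP => /(proper_col_neq prop); rewrite (mono l x y) eqxx.
pose ci := c (g (i, a u0)); pose cj := c (g (j, b w0)).
have cij : ci != cj by apply: (proper_col_neq prop); rewrite adj.
have /forallP/(_ cj)/implyP/(_ cij)/existsP[] := av ci.
exists [ffun v => if v \in A then g (i, a v) else g (j, b v)].
have nA v : (v \in A) = false -> v \in ~: A by rewrite inE => ->.
apply/and3P; split.
- apply/injectiveP => u v; rewrite !ffunE.
  case: ifP => uA; case: ifP => vA => /injg[].
  + exact: inja.
  + by move=> eij; rewrite eij eqxx in ij.
  + by move=> eij; rewrite eij eqxx in ij.
  + by apply: injb; apply: nA.
- apply/forallP => v; rewrite ffunE.
  case: ifP => _; rewrite /ci /cj; first by rewrite (mono _ _ (a u0)) eqxx.
  by rewrite (mono _ (b v) (b w0)) eqxx orbT.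
- apply/forallP => u; apply/forallP => v; rewrite !ffunE; apply/eqP.
  case: ifP => uA; case: ifP => vA.
  + by rewrite row_adj iAe.
  + by rewrite adj ?nA.
  + by rewrite gadj_sym adj ?nA //; case: simple_e => ->.
  + by rewrite row_adj iBe ?nA.
Qed.

Lemma card_le_injection r (A : {set V}) : (0 < r)%N -> (#|A| <= r)%N ->
  exists a : V -> 'I_r, {in A &, injective a}.
Proof.
case: r => // r _ Ar; exists (fun v => inord (index v (enum A))) => u v uA vA.
have lt w : w \in A -> (index w (enum A) < r.+1)%N.
  by move=> wA; apply: leq_trans Ar; rewrite cardE index_mem mem_enum.
move=> /(congr1 val) /=; rewrite !inordK ?lt // => euv.
have := nth_index u (_ : u \in enum A); rewrite mem_enum => <- //.
by rewrite euv nth_index // mem_enum.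
Qed.

Lemma exists_H_pattern : bipartite e -> (1 < k1 e)%N -> (1 < k2 e)%N ->
  exists M : {set 'I_(k1 e) * 'I_(k1 e)},
  forall n k (E : {set 'I_n * 'I_n}) (c : {ffun 'I_n -> 'I_k})
    m (g : 'I_m * 'I_(k1 e) -> 'I_n),
  H_avoiding e E c -> injective g ->
  (forall i a b, c (g (i, a)) = c (g (i, b))) -> avoids (pred1 M) E g.
Proof.
move=> bip k1_gt1 k2_gt1; have [A bA] := k1_attained bip.
have k1_gt0 := ltnW k1_gt1.
rewrite geq_max => /andP[/(card_le_injection k1_gt0)[a inja]].
move=> /(card_le_injection k1_gt0)[b injb].
have [u uA [w wB euw]] : exists2 u, u \in A & exists2 w, w \in ~: A & e u w.
  have [/existsP[u /andP[uA /existsP[w /andP[wB euw]]]]|] :=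
    boolP [exists u, (u \in A) && [exists w, (w \in ~: A) && e u w]].
    by exists u => //; exists w.
  move=> /existsPn none.
  have noAB u w : u \in A -> w \in ~: A -> e u w = false.
    move=> uA wB; have := none u; rewrite uA /= => /existsPn/(_ w).
    by rewrite wB => /negbTE.
  suff /k2_le : bipartition e set0 by rewrite cards0 min0n leqNgt (ltnW k2_gt1).
  case/andP: bA => /forall_inP iA /forall_inP iB.
  apply/andP; split; first by apply/forall_inP => x; rewrite inE.
  apply/forall_inP => x _; apply/forall_inP => y _.
  have [[xA|xB] [yA|yB]] : ((x \in A) \/ (x \in ~: A)) /\ ((y \in A) \/ (y \in ~: A)).
  - by rewrite !inE; do 2!case: (_ \in A); split; auto.
  - by have /forall_inP := iA _ xA; apply.
  - by rewrite noAB.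
  - by case: simple_e => -> _; rewrite noAB.
  - by have /forall_inP := iB _ xB; apply.
pose M := [set ab : 'I_(k1 e) * 'I_(k1 e) |
  [exists u in A, exists w in ~: A, [&& a u == ab.1, b w == ab.2 & e u w]]].
exists M => n k E c m g av injg mono.
apply/forallP => i; apply/forallP => j; apply/implyP => ij /=.
apply: (pattern_avoided (A := A) (a := a) (b := b) (c := c)) => //.
- move=> x y xA yB; rewrite inE.
  apply/idP/idP => [|exy].
    case/exists_inP => u' u'A /exists_inP[w' w'B /= /and3P[/eqP ea /eqP eb]].
    by rewrite (inja _ _ u'A xA ea) (injb _ _ w'B yB eb).
  by apply/exists_inP; exists x => //; apply/exists_inP; exists y; rewrite //= !eqxx.
- by exists u => //; exists w.
- by rewrite neq_ltn ij.
Qed.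

Lemma chiH_lower r (Pat : pred {set 'I_r * 'I_r}) n (E : {set 'I_n * 'I_n}) m :
  (forall k (c : {ffun 'I_n -> 'I_k}) (g : 'I_m * 'I_r -> 'I_n),
     H_avoiding e E c -> injective g ->
     (forall i a b, c (g (i, a)) = c (g (i, b))) -> avoids Pat E g) ->
  ~~ [exists g : {ffun 'I_m * 'I_r -> 'I_n}, injectiveb g && avoids Pat E g] ->
  (n < chiH e E)%N || (n + r <= chiH e E * r.-1 + r * m)%N.
Proof.
move=> HPat /existsPn none; case: (ltnP n) => //= chin.
have [c avc] := chiH_colouring chin.
rewrite leqNgt; apply/negP => lt.
have [|g [injg mono]] := @mono_rows n _ r m c.
  by rewrite addnAC addn1.
have /negP[] := none [ffun q => g q]; apply/andP; split.
  by apply/injectiveP => x y; rewrite !ffunE => /injg.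
have /forallP av := HPat _ c g avc injg mono.
apply/forallP => i; apply/forallP => j; have /forallP/(_ j) := av i.
suff -> : cross E [ffun q => g q] i j = cross E g i j by [].
by apply/setP => ab; rewrite !inE !ffunE.
Qed.

End HPattern.

Lemma twoK2_simple : simple_graph twoK2.
Proof.
split; last by case=> [[|[|[|[|?]]]] ?].
by case=> [[|[|[|[|?]]]] ?] [[|[|[|[|?]]]] ?].
Qed.

Lemma twoK2_k2 : (1 < k2 twoK2)%N.
Proof.
apply: (big_ind (fun x => 1 < x)%N) => [|x y|A /andP[/forall_inP iA /forall_inP iB]].
- by rewrite card_ord.
- by rewrite /minn; case: ifP.
have cut u v : twoK2 u v -> (u \in A) = (v \notin A).
  move=> uv; have [uA|uA] := boolP (u \in A).
    by apply/esym/negP => vA; have /forall_inP/(_ v vA) := iA u uA; rewrite uv.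
  apply/esym/negbTE; rewrite negbK; apply/negPn/negP => vA.
  have uB : u \in ~: A by rewrite inE.
  have vB : v \in ~: A by rewrite inE.
  by have /forall_inP/(_ v vB) := iB u uB; rewrite uv.
pose o (k : nat) : 'I_4 := inord k.
have oE k : (k < 4)%N -> o k = k :> nat by move=> k4; rewrite inordK.
have c01 : twoK2 (o 0%N) (o 1%N) by rewrite /twoK2 !oE.
have c23 : twoK2 (o 2%N) (o 3%N) by rewrite /twoK2 !oE.
have gt1 (B : {set 'I_4}) : (forall u v, twoK2 u v -> (u \in B) = (v \notin B)) ->
    (1 < #|B|)%N.
  move=> cutB; apply/card_gt1P.
  exists (if o 0%N \in B then o 0%N else o 1%N).
  exists (if o 2%N \in B then o 2%N else o 3%N).
  have := cutB _ _ c01; have := cutB _ _ c23.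
  by case: ifP => h2; case: ifP => h0 /esym h3 /esym h1;
    (split; [| |apply/eqP => /(congr1 val); rewrite /= !inordK]) => //;
    move: h1 h3; case: (_ \in B); case: (_ \in B).
have hA : (1 < #|A|)%N by apply: gt1.
have hB : (1 < #|~: A|)%N.
  by apply: gt1 => u v /cut; rewrite !inE => ->; case: (_ \in A).
by move: hA hB; rewrite /minn; case: ifP.
Qed.

Definition twoK2_pat (M : {set 'I_2 * 'I_2}) : bool :=
  (M == [set ab | ab.1 == ab.2]) || (M == [set ab | ab.1 != ab.2]).

Lemma twoK2_avoids n k (E : {set 'I_n * 'I_n}) (c : {ffun 'I_n -> 'I_k})
    m (g : 'I_m * 'I_2 -> 'I_n) :
  H_avoiding twoK2 E c -> injective g ->
  (forall i a b, c (g (i, a)) = c (g (i, b))) -> avoids twoK2_pat E g.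
Proof.
move=> av injg mono; apply/forallP => i; apply/forallP => j; apply/implyP => ij.
pose A := [set v : 'I_4 | ~~ odd v].
pose a (v : 'I_4) : 'I_2 := inord v./2.
pose b (v : 'I_4) : 'I_2 := inord (1 - v./2).
have aE v : a v = v./2 :> nat by rewrite inordK //; case: v => [[|[|[|[|?]]]] ?].
have bE v : b v = (1 - v./2)%N :> nat by rewrite inordK // ltnS leq_subr.
have bA : bipartition twoK2 A.
  by apply/andP; split; apply/forall_inP => u; rewrite !inE => uA;
    apply/forall_inP => v; rewrite !inE => vA; move: uA vA;
    case: u => [[|[|[|[|?]]]] ?]; case: v => [[|[|[|[|?]]]] ?].
have ne : i != j by rewrite neq_ltn ij.
have ex : exists2 u, u \in A & exists2 w, w \in ~: A & twoK2 u w.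
  by exists (inord 0); [|exists (inord 1)]; rewrite /twoK2 ?inE !inordK.
have injab (f : 'I_4 -> 'I_2) (B : {set 'I_4}) :
    (forall u v : 'I_4, u \in B -> v \in B -> f u = f v :> nat -> u = v :> nat) ->
    {in B &, injective f}.
  by move=> H u v uB vB /(congr1 val) /(H u v uB vB) /val_inj.
rewrite negb_or; apply/andP; split.
- apply: (pattern_avoided twoK2_simple (A := A) (a := a) (b := a) (c := c)) => //.
  + apply: injab => u v; rewrite !inE !aE.
    by case: u => [[|[|[|[|?]]]] ?]; case: v => [[|[|[|[|?]]]] ?].
  + apply: injab => u v; rewrite !inE !aE.
    by case: u => [[|[|[|[|?]]]] ?]; case: v => [[|[|[|[|?]]]] ?].
  + move=> u v; rewrite !inE -val_eqE /= !aE.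
    by case: u => [[|[|[|[|?]]]] ?]; case: v => [[|[|[|[|?]]]] ?].
- apply: (pattern_avoided twoK2_simple (A := A) (a := a) (b := b) (c := c)) => //.
  + apply: injab => u v; rewrite !inE !aE.
    by case: u => [[|[|[|[|?]]]] ?]; case: v => [[|[|[|[|?]]]] ?].
  + apply: injab => u v; rewrite !inE !bE.
    by case: u => [[|[|[|[|?]]]] ?]; case: v => [[|[|[|[|?]]]] ?].
  + move=> u v; rewrite !inE -val_eqE /= aE bE.
    by case: u => [[|[|[|[|?]]]] ?]; case: v => [[|[|[|[|?]]]] ?].
Qed.

(** * Second moment of the number of independent sets *)

Lemma leq_bin_sub n k l : (l <= k)%N -> (k <= n)%N ->
  ('C(n - l, k - l) * n ^ l <= 'C(n, k) * k ^ l)%N.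
Proof.
move=> + kn; elim: l => [|l IH] lk; first by rewrite !subn0.
have {}IH := IH (ltnW lk).
have nl : (0 < n - l)%N by lia.
rewrite -(leq_pmul2l nl).
have e : ((n - l) * 'C(n - l.+1, k - l.+1) = (k - l) * 'C(n - l, k - l))%N.
  have := mul_bin_diag (n - l) (k - l.+1).
  by rewrite -!subnS (_ : (k - l.+1).+1 = k - l)%N //; lia.
rewrite mulnA e !expnS.
have h : ((k - l) * n <= (n - l) * k)%N by nia.
have := leq_mul h IH.
by congr (_ <= _)%N; ring.
Qed.

Lemma leq_bin_exp n k : ('C(n, k) <= n ^ k)%N.
Proof.
elim: k => [|k IH]; first by rewrite bin0.
apply: (@leq_trans (k.+1 * 'C(n, k.+1))); first by rewrite leq_pmull.
by rewrite mul_bin_left expnS leq_mul // leq_subr.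
Qed.

Lemma card_supersets (T : finType) (U : {set T}) k : (#|U| <= k)%N ->
  (#|[set S : {set T} | (#|S| == k) && (U \subset S)]| <=
   'C(#|T| - #|U|, k - #|U|))%N.
Proof.
move=> Uk; have -> : (#|T| - #|U| = #|~: U|)%N by rewrite [RHS]cardsCs setCK.
rewrite -cards_draws.
rewrite -(card_in_imset (f := fun S : {set T} => S :\: U)).
  apply/subset_leq_card/subsetP => _ /imsetP[S + ->].
  rewrite !inE => /andP[/eqP cS US].
  by rewrite setDE subsetIr /= -setDE cardsD (setIidPr US) cS.
move=> S S'; rewrite !inE => /andP[_ US] /andP[_ US'] e.
by rewrite -(setID S U) -(setID S' U) e (setIidPr US) (setIidPr US').
Qed.

Lemma sum_geometric_le2 (R : realType) (x : R) n : 0 <= x -> x <= 2^-1 ->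
  \sum_(i < n) x ^+ i <= 2.
Proof.
move=> x0 x2; elim: n => [|n IH]; first by rewrite big_ord0.
rewrite big_ord_recl expr0.
under eq_bigr do rewrite lift0 exprS.
rewrite -mulr_sumr; have : 0 <= \sum_(i < n) x ^+ i.
  by apply: sumr_ge0 => i _; rewrite exprn_ge0.
nra.
Qed.

Section SecondMoment.
Context {R : realType} {p sd : R} {n k : nat}.
Hypothesis p01 : 0 < p < 1.
Hypothesis sd1 : 1 <= sd.
Hypothesis sdE : sd ^+ 2 = (1 - p)^-1.
Hypothesis k_gt0 : (0 < k)%N.
Hypothesis kn : (k <= n)%N.
Let x : R := k%:R ^+ 2 * sd ^+ k / n%:R.
Hypothesis x2 : x <= 2^-1.

Let y : R := k%:R * sd ^+ k / n%:R.

Let sd0 : 0 <= sd. Proof. exact: le_trans sd1. Qed.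
Let y0 : 0 <= y. Proof. by rewrite /y divr_ge0 ?mulr_ge0 ?exprn_ge0. Qed.
Let x0 : 0 <= x. Proof. by rewrite /x divr_ge0 ?mulr_ge0 ?exprn_ge0. Qed.
Let xE : x = k%:R * y. Proof. by rewrite /x /y; ring. Qed.
Let n_gt0 : 0 < n%:R :> R. Proof. by rewrite ltr0n (leq_trans k_gt0). Qed.
Let q0 : 0 < 1 - p. Proof. by case/andP: p01 => *; lra. Qed.

Lemma sum_subsets_le (S : {set 'I_n}) : #|S| = k ->
  \sum_(U : {set 'I_n} | (U \subset S) && (1 < #|U|)%N) y ^+ #|U| <= 2 * x ^+ 2.
Proof.
move=> cS.
rewrite (partition_big (fun U : {set 'I_n} => inord #|U| : 'I_k.+1)
  (fun l : 'I_k.+1 => (1 < l)%N)) /=; last first.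
  move=> U /andP[US U1]; rewrite inordK // ltnS -cS; exact: subset_leq_card.
apply: (@le_trans _ _ (\sum_(l < k.+1 | (1 < l)%N) x ^+ l)).
  apply: ler_sum => l l1.
  apply: (@le_trans _ _
    (\sum_(U in [set A : {set 'I_n} | A \subset S & #|A| == l]) y ^+ l)).
    rewrite le_eqVlt; apply/orP; left; apply/eqP.
    apply: eq_big => [U|U /andP[/andP[US _] /eqP <-]].
      rewrite inE; apply/idP/idP.
        move=> /andP[/andP[US _] /eqP <-]; rewrite US inordK ?eqxx //.
        by rewrite ltnS -cS; exact: subset_leq_card.
      move=> /andP[US /eqP cU]; rewrite US cU l1 /=; apply/eqP/val_inj.
      by rewrite /= inordK.
    by rewrite inordK // ltnS -cS; exact: subset_leq_card.
  rewrite sumr_const cards_draws cS -[leLHS]mulr_natl xE [leRHS]exprMn.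
  rewrite ler_wpM2r ?exprn_ge0 // -natrX ler_nat.
  exact: leq_bin_exp.
move: k_gt0; case: k => // k' _.
rewrite big_mkcond big_ord_recl big_ord_recl /= !add0r.
rewrite (eq_bigr (fun i : 'I_k' => x ^+ 2 * x ^+ i)) => [|i _]; last first.
  by rewrite /bump /= !add1n -exprD.
by rewrite -mulr_sumr mulrC ler_wpM2r ?exprn_ge0 // sum_geometric_le2.
Qed.

Lemma sd_bin2_le l : (l <= k)%N -> (1 - p) ^- 'C(l, 2) <= (sd ^+ k) ^+ l.
Proof.
move=> lk; rewrite -exprVn -sdE -!exprM mul_bin_left bin1.
by rewrite ler_weXn2l // leq_mul2r; lia.
Qed.

Lemma sum_overlap_le (S : {set 'I_n}) : #|S| = k ->
  \sum_(T : {set 'I_n} | #|T| == k) (1 - p) ^- 'C(#|S :&: T|, 2) <=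
  'C(n, k)%:R * (1 + 2 * x ^+ 2).
Proof.
move=> cS; pose w (U : {set 'I_n}) : R := (1 - p) ^- 'C(#|U|, 2).
have w0 U : 0 <= w U by rewrite invr_ge0 exprn_ge0 // ltW.
apply: (@le_trans _ _ (\sum_(T : {set 'I_n} | #|T| == k) (1 +
   \sum_(U : {set 'I_n} | (U \subset S) && (1 < #|U|)%N) (U \subset T)%:R * w U))).
  apply: ler_sum => T _; case: (ltnP 1 #|S :&: T|) => h; last first.
    rewrite (_ : 'C(_, 2) = 0)%N ?expr0 ?invr1 ?lerDl ?bin_small //.
    by apply: sumr_ge0 => U _; rewrite mulr_ge0.
  rewrite (bigD1 (S :&: T)) ?subsetIl //= subsetIr mul1r -/(w (S :&: T)).
  rewrite addrCA lerDl addr_ge0 // sumr_ge0 // => U _; rewrite mulr_ge0 //.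
rewrite big_split /= exchange_big /= mulrDr lerD //.
  rewrite (eq_bigl (mem [set T : {set 'I_n} | #|T| == k])); last first.
    by move=> T; rewrite /= inE.
  by rewrite sumr_const card_draws card_ord mulr1.
apply: (@le_trans _ _ ('C(n, k)%:R *
    \sum_(U : {set 'I_n} | (U \subset S) && (1 < #|U|)%N) y ^+ #|U|)); last first.
  by rewrite ler_wpM2l // sum_subsets_le.
rewrite mulr_sumr; apply: ler_sum => U /andP[US U1].
have Uk : (#|U| <= k)%N by rewrite -cS subset_leq_card.
rewrite -mulr_suml -natr_sum.
have cU : (\sum_(T : {set 'I_n} | #|T| == k) (U \subset T) <=
    'C(n - #|U|, k - #|U|))%N.
  apply: leq_trans (_ : _ <= #|[set T : {set 'I_n} | (#|T| == k) && (U \subset T)]|)%N _.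
    by rewrite -sum1_card big_mkcond [leqRHS]big_mkcond /=;
       apply: leq_sum => T _; rewrite inE; case: (_ == _); case: (_ \subset _).
  by have := card_supersets Uk; rewrite card_ord.
have : (\sum_(T : {set 'I_n} | #|T| == k) (U \subset T))%:R * n%:R ^+ #|U| <=
    'C(n, k)%:R * k%:R ^+ #|U| :> R.
  rewrite -!natrX -!natrM ler_nat (leq_trans _ (leq_bin_sub Uk kn)) //.
  by rewrite leq_mul2r cU orbT.
rewrite -ler_pdivlMr ?exprn_gt0 // => cU'.
apply: le_trans (ler_wpM2r (w0 U) cU') _.
have -> : y ^+ #|U| = k%:R ^+ #|U| / n%:R ^+ #|U| * (sd ^+ k) ^+ #|U|.
  by rewrite /y !exprMn exprVn; ring.
rewrite [leRHS]mulrA [X in _ <= X * _]mulrA ler_wpM2l ?sd_bin2_le //.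
by rewrite divr_ge0 ?mulr_ge0 ?exprn_ge0.
Qed.

Lemma prob_no_indep_set :
  gnp_prob p (fun E => ~~ [exists S : {set 'I_n},
     (#|S| == k) && (E :&: inner_pairs S == set0)]) <= 2 * x ^+ 2.
Proof.
pose f (E : {set 'I_n * 'I_n}) : R :=
  \sum_(S : {set 'I_n} | #|S| == k) (E :&: inner_pairs S == set0)%:R.
pose N : R := 'C(n, k)%:R.
have N0 : 0 < N by rewrite ltr0n bin_gt0.
have p01' : 0 <= p <= 1 by case/andP: p01 => *; rewrite !ltW.
pose m := N * (1 - p) ^+ 'C(k, 2).
have m0 : 0 < m by rewrite mulr_gt0 ?exprn_gt0.
have sumN (c : R) : \sum_(S : {set 'I_n} | #|S| == k) c = N * c.
  rewrite (eq_bigl (mem [set T : {set 'I_n} | #|T| == k])); last first.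
    by move=> T; rewrite /= inE.
  by rewrite sumr_const card_draws card_ord mulr_natl.
have fm : bern p (upairs n) f = m.
  rewrite bern_sum /m -sumN; apply: eq_bigr => S /eqP cS.
  by rewrite bern_avoid ?inner_pairs_sub // card_inner_pairs cS.
have ff : bern p (upairs n) (fun E => f E ^+ 2) <= m ^+ 2 * (1 + 2 * x ^+ 2).
  have -> : bern p (upairs n) (fun E => f E ^+ 2) =
      \sum_(S : {set 'I_n} | #|S| == k) \sum_(T : {set 'I_n} | #|T| == k)
        (1 - p) ^+ 'C(k, 2) ^+ 2 * (1 - p) ^- 'C(#|S :&: T|, 2).
    rewrite (eq_bern (g := fun E => \sum_(S : {set 'I_n} | #|S| == k)
        \sum_(T : {set 'I_n} | #|T| == k)
        (E :&: (inner_pairs S :|: inner_pairs T) == set0)%:R)); last first.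
      move=> E _; rewrite expr2 mulr_suml; apply: eq_bigr => S _.
      rewrite mulr_sumr; apply: eq_bigr => T _.
      by rewrite setIUr setU_eq0 -natrM mulnb.
    rewrite bern_sum; apply: eq_bigr => S /eqP cS.
    rewrite bern_sum; apply: eq_bigr => T /eqP cT.
    rewrite bern_avoid ?subUset ?inner_pairs_sub //.
    have qU : (1 - p) ^+ 'C(#|S :&: T|, 2) \is a GRing.unit.
      by rewrite unitfE expf_neq0 // gt_eqF.
    apply: (mulIr qU); rewrite -mulrA mulVr // mulr1.
    rewrite -exprD -exprM; congr (_ ^+ _).
    rewrite -card_inner_pairs -inner_pairsI cardsUI !card_inner_pairs cS cT.
    by rewrite muln2 addnn.
  apply: (@le_trans _ _ (\sum_(S : {set 'I_n} | #|S| == k)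
     (1 - p) ^+ 'C(k, 2) ^+ 2 * (N * (1 + 2 * x ^+ 2)))).
    apply: ler_sum => S /eqP cS; rewrite -mulr_sumr ler_wpM2l ?sum_overlap_le //.
    by rewrite exprn_ge0 ?exprn_ge0 ?ltW.
  by rewrite sumN /m le_eqVlt; apply/orP; left; apply/eqP; ring.
have := second_moment p01' m0 fm; set c := bern p (upairs n) (fun E => _%:R) => le_c.
have -> : gnp_prob p (fun E => ~~ [exists S : {set 'I_n},
     (#|S| == k) && (E :&: inner_pairs S == set0)]) = c.
  apply: eq_bern => E _; congr (nat_of_bool _)%:R.
  apply/existsPn/eqP => [none|f0 S].
    apply: big1 => S cS; have := none S; rewrite cS /=.
    by move/negbTE ->.
  apply/negP => /andP[cS ES]; move/eqP: f0.
  by rewrite /f (bigD1 S) //= ES gt_eqF // ltr_pwDl // sumr_ge0.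
apply: le_trans le_c _; rewrite ler_pdivrMr ?exprn_gt0 // lerBlDr.
by apply: le_trans ff _; rewrite mulrDr mulr1 addrC mulrC.
Qed.

End SecondMoment.

(** * Asymptotics and high probability *)

Definition eventually (P : nat -> Prop) : Prop :=
  exists N, forall n, (N <= n)%N -> P n.

Lemma eventually_and (P Q : nat -> Prop) :
  eventually P -> eventually Q -> eventually (fun n => P n /\ Q n).
Proof.
move=> [N HN] [M HM]; exists (maxn N M) => n; rewrite geq_max => /andP[Nn Mn].
by split; [apply: HN|apply: HM].
Qed.

Lemma eventually_mono (P Q : nat -> Prop) :
  (forall n, P n -> Q n) -> eventually P -> eventually Q.
Proof. by move=> PQ [N HN]; exists N => n /HN/PQ. Qed.

Section LnGrowth.
Context {R : realType}.

Lemma eventually_ln (M : R) : eventually (fun n => M <= ln (n%:R : R)).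
Proof.
exists (Num.truncn (expR M)).+1 => n Nn.
have n_ge : expR M <= n%:R.
  by apply: le_trans (ltW (truncnS_gt _)) _; rewrite ler_nat.
rewrite -ler_expR lnK // posrE; apply: lt_le_trans n_ge; exact: expR_gt0.
Qed.

Lemma eventually_lnln (M : R) : eventually (fun n => M <= ln (ln (n%:R : R))).
Proof.
apply: eventually_mono (eventually_ln (expR M)) => n Hn.
rewrite -ler_expR lnK // posrE; apply: lt_le_trans Hn; exact: expR_gt0.
Qed.

Lemma eventually_ln_sqr (M : R) :
  eventually (fun n => M * ln (n%:R : R) ^+ 2 <= n%:R).
Proof.
apply: eventually_mono
  (eventually_and (eventually_ln 1) (eventually_ln (6 * M))) => n [L1 LM].
have n0 : 0 < n%:R :> R.
  by rewrite ltr0n; case: n L1 {LM} => // L1; move: L1; rewrite ln0 //; lra.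
have := @expR_ge1Dxn R (ln n%:R) 2 (le_trans ler01 L1).
rewrite lnK ?posrE // (_ : 3`!%:R = 6 :> R) //.
move=> h; apply: le_trans h; rewrite (_ : _ ^+ 3 = ln n%:R ^+ 2 * ln n%:R); last by ring.
set L := ln _ in L1 LM *; have : 0 <= L ^+ 2 by exact: sqr_ge0.
nra.
Qed.

Lemma eventually_lnln_ln (M : R) :
  eventually (fun n => M * ln (ln (n%:R : R)) <= ln n%:R).
Proof.
apply: eventually_mono (eventually_and (eventually_ln 1)
  (eventually_and (eventually_lnln 0) (eventually_lnln (2 * M)))) => n [L1 [l0 lM]].
have := @expR_ge1Dxn R (ln (ln n%:R)) 1 l0.
rewrite lnK ?posrE ?(lt_le_trans ltr01) // (_ : 2`!%:R = 2 :> R) //.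
by set l := ln (ln _) in l0 lM *; nra.
Qed.

Lemma expr_expR_ln (x : R) k : 0 < x -> x ^+ k = expR (k%:R * ln x).
Proof. by move=> x0; rewrite expRM_natl lnK. Qed.

Lemma bin2_real m : ('C(m, 2))%:R = m%:R * (m%:R - 1) / 2 :> R.
Proof.
have : (2 * 'C(m, 2))%:R = (m.-1 * m)%:R :> R.
  by rewrite mul_bin_left bin1 subn1.
rewrite !natrM; case: m => [|m] /=; first by lra.
rewrite -[m.+1]addn1 natrD; lra.
Qed.

Lemma fact_ge_expR m : expR (m%:R * (ln m%:R - 1)) <= m`!%:R :> R.
Proof.
case: m => [|m]; first by rewrite mul0r expR0.
have := @expR_ge1Dxn R m.+1%:R m (ler0n _ _).
rewrite mulrBr mulr1 expRB expRM_natl lnK ?posrE ?ltr0n //.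
rewrite ler_pdivrMr ?expR_gt0 // => h.
have : m.+1%:R ^+ m.+1 / m.+1`!%:R <= expR m.+1%:R :> R by lra.
by rewrite ler_pdivrMr ?ltr0n ?fact_gt0 // mulrC.
Qed.

End LnGrowth.

Section Whp.
Context {R : realType} {p : R}.
Hypothesis p01 : 0 <= p <= 1.

Lemma gnp_probC n (P : {set 'I_n * 'I_n} -> bool) :
  gnp_prob p P = 1 - gnp_prob p (fun E => ~~ P E).
Proof.
apply/eqP; rewrite eq_sym subr_eq; apply/eqP.
rewrite -(bern_cst (p := p) (upairs n) 1) -bernD; apply: eq_bern => E _.
by case: (P E); rewrite ?addr0 ?add0r.
Qed.

Lemma whp_of_fail (P : forall n : nat, {set 'I_n * 'I_n} -> bool) :
  (forall eps : R, 0 < eps ->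
     eventually (fun n => gnp_prob p (fun E => ~~ P n E) <= eps)) ->
  whp p P.
Proof.
move=> H eps /H [N HN]; exists N => n /HN; rewrite [gnp_prob p (P n)]gnp_probC; lra.
Qed.

Lemma whp_imp2 (P Q S : forall n : nat, {set 'I_n * 'I_n} -> bool) :
  whp p P -> whp p Q ->
  eventually (fun n => forall E : {set 'I_n * 'I_n},
    E \subset upairs n -> P n E -> Q n E -> S n E) ->
  whp p S.
Proof.
move=> wP wQ [N0 H0] eps eps0.
have [N1 H1] := wP (eps / 2) (divr_gt0 eps0 (ltr0Sn _ 1)).
have [N2 H2] := wQ (eps / 2) (divr_gt0 eps0 (ltr0Sn _ 1)).
exists (maxn N0 (maxn N1 N2)) => n; rewrite !geq_max => /and3P[/H0 h0 /H1 h1 /H2 h2].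
suff : gnp_prob p (P n) + gnp_prob p (Q n) <= gnp_prob p (S n) + 1 by lra.
rewrite -(bern_cst (p := p) (upairs n) 1) -!bernD; apply: ler_bern => // E sE.
have := h0 E sE; case: (P n E); case: (Q n E); case: (S n E) => /= H; try lra.
Qed.

Lemma whp_imp (P S : forall n : nat, {set 'I_n * 'I_n} -> bool) :
  whp p P ->
  eventually (fun n => forall E : {set 'I_n * 'I_n},
    E \subset upairs n -> P n E -> S n E) ->
  whp p S.
Proof.
move=> wP H; apply: (whp_imp2 wP wP).
by apply: eventually_mono H => n h E sE /(h _ sE).
Qed.

Lemma bern_not_pred1_lt1 k (M : {set 'I_k * 'I_k}) : 0 < p < 1 ->
  bern p [set: 'I_k * 'I_k] (fun X => (~~ pred1 M X)%:R) < 1.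
Proof.
case/andP=> p0 p1.
have : 0 < bern p [set: 'I_k * 'I_k] (fun X => (X == M)%:R).
  rewrite /bern (bigD1 M) ?subsetT //= eqxx mulr1 ltr_pwDl //.
    by rewrite mulr_gt0 ?exprn_gt0 ?subr_gt0.
  by apply: sumr_ge0 => X _; rewrite mulr_ge0 ?bern_weight_ge0.
suff : bern p [set: 'I_k * 'I_k] (fun X => (X == M)%:R) +
   bern p [set: 'I_k * 'I_k] (fun X => (~~ pred1 M X)%:R) = 1 by lra.
rewrite -[RHS](bern_cst (p := p) [set: 'I_k * 'I_k]) -bernD.
by apply: eq_bern => X _ /=; case: (X == M); rewrite ?addr0 ?add0r.
Qed.

Lemma whp_no_avoiding_rows k (Pat : pred {set 'I_k * 'I_k}) :
  bern p [set: 'I_k * 'I_k] (fun M => (~~ Pat M)%:R) < 1 ->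
  exists2 C : R, 0 <= C & whp p (fun n E =>
    ~~ [exists g : {ffun 'I_(Num.truncn (C * ln (n%:R : R))).+2 * 'I_k -> 'I_n},
          injectiveb g && avoids Pat E g]).
Proof.
set B := bern _ _ _ => B1.
have B0 : 0 <= B by apply: sumr_ge0 => E _; rewrite mulr_ge0 ?bern_weight_ge0.
pose q := Num.max B 2^-1.
have q0 : 0 < q by rewrite lt_max invr_gt0 ltr0Sn orbT.
have q1 : q < 1 by rewrite gt_max B1 /=; lra.
have lam0 : ln q < 0 by rewrite ln_lt0 // q0.
pose C := - (2 * (k%:R + 1) / ln q).
have C0 : 0 <= C.
  rewrite /C -mulrN -invrN; apply: divr_ge0; last by lra.
  by rewrite mulr_ge0 // addr_ge0.
exists C => //; apply: whp_of_fail => eps eps0.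
apply: eventually_mono (eventually_and (eventually_ln 1)
   (eventually_ln (- ln eps))) => n [L1 Leps].
set m := (Num.truncn _).+2.
have n0 : 0 < n%:R :> R.
  by rewrite ltr0n; case: n L1 {Leps m} => // L1; move: L1; rewrite ln0 //; lra.
have := @prob_exists_avoids n m k R p Pat 1 p01.
rewrite mulr1 -/B => H.
rewrite [leLHS](_ : _ = gnp_prob p (fun E => [exists g : {ffun 'I_m * 'I_k -> 'I_n},
          injectiveb g && avoids Pat E g])); last first.
  by apply: eq_bern => E _; rewrite negbK.
apply: le_trans (H _) _ => [E g injg ag|].
  rewrite card_gt0; apply/set0Pn; exists [ffun q => g q]; rewrite inE.
  apply/andP; split; first by apply/injectiveP => x y; rewrite !ffunE => /injg.
  rewrite (_ : avoids _ _ _ = avoids Pat E g) //.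
  by apply: eq_forallb => i; apply: eq_forallb => j; congr (_ ==> ~~ Pat _);
    apply/setP => ab; rewrite !inE !ffunE.
apply: (@le_trans _ _ (n%:R ^+ (m * k) * q ^+ 'C(m, 2))).
  by rewrite ler_wpM2l ?exprn_ge0 // lerXn2r ?nnegrE ?(ltW q0) // le_max lexx.
rewrite !expr_expR_ln // -expRD -[leRHS]lnK ?posrE // ler_expR.
set L := ln n%:R in L1 Leps *.
have m1 : C * L < m%:R - 1.
  by rewrite ltrBrDr /m -[_.+2]addn1 natrD ltrD2r truncnS_gt.
have m_ge1 : 1 <= m%:R :> R by rewrite ler1n.
have h : C * L * ln q = - (2 * (k%:R + 1) * L).
  by rewrite /C mulNr mulNr mulrAC divfK // lt_eqF.
rewrite bin2_real natrM.
have h2 : (m%:R - 1) * ln q <= - (2 * (k%:R + 1) * L).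
  by rewrite -h ler_wnM2r // ltW.
apply: (@le_trans _ _ (m%:R * (k%:R * L + (- (2 * (k%:R + 1) * L)) / 2))).
  rewrite [leLHS](_ : _ = m%:R * (k%:R * L + ((m%:R - 1) * ln q) / 2)); last by ring.
  by rewrite ler_wpM2l // lerD2l ler_pM2r ?invr_gt0.
rewrite [X in _ * X](_ : _ = - L); last by field.
rewrite mulrN; apply: (@le_trans _ _ (- L)); last by rewrite lerNl.
by rewrite lerN2 ler_peMl // (le_trans _ L1).
Qed.

End Whp.

(** * Bounds on the H-avoiding chromatic number *)

Lemma gadj_irr n (E : {set 'I_n * 'I_n}) : E \subset upairs n ->
  irreflexive (gadj E).
Proof. by move=> sE x; rewrite gadj_edge // eqxx. Qed.

Definition has_indep (n : nat) (E : {set 'I_n * 'I_n}) (U : {set 'I_n}) r : bool :=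
  [exists S : {set 'I_n}, [&& S \subset U, (r <= #|S|)%N & independent (gadj E) S]].

Section Bounds.
Context {R : realType} {p : R}.
Hypotheses (hp0 : 0 < p) (hp1 : p < 1).

Let p01 : 0 <= p <= 1. Proof. by rewrite !ltW. Qed.
Let p01s : 0 < p < 1. Proof. by rewrite hp0. Qed.

Lemma whp_chiH_lower (V : finType) (e : rel V) :
  simple_graph e -> bipartite e -> (1 < k1 e)%N -> (1 < k2 e)%N ->
  exists C : R, whp p (fun n E =>
    n%:R / ((k1 e).-1)%:R - C * ln n%:R <= (chiH e E)%:R).
Proof.
move=> simp bip k1_gt1 k2_gt1.
have [M HM] := exists_H_pattern simp bip k1_gt1 k2_gt1.
have [C C0 wC] := whp_no_avoiding_rows p01 (bern_not_pred1_lt1 p01 M p01s).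
set r := k1 e in k1_gt1 M HM wC *.
exists (r%:R * (C + 2)); apply: (whp_imp p01 wC).
apply: eventually_mono (eventually_ln (1 : R)) => n L1 E sE none.
set m := (Num.truncn _).+2 in none.
have r1 : 1 <= (r.-1)%:R :> R by rewrite ler1n -ltnS prednK // ltnW.
have r0 : 0 < (r.-1)%:R :> R by apply: lt_le_trans r1.
set L := @ln R n%:R in L1 m none *.
have mL : m%:R <= (C + 2) * L.
  have : (Num.truncn (C * L))%:R <= C * L.
    by rewrite truncn_le mulr_ge0 // (le_trans _ L1).
  by move=> h; rewrite mulrDl /m -addn2 natrD lerD //; lra.
clearbody m.
rewrite lerBlDr ler_pdivrMr //.
have /orP[lt|le] := chiH_lower (fun k c g => HM n k E c m g) none.
  have : n%:R <= (chiH e E)%:R :> R by rewrite ler_nat ltnW.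
  have : 0 <= r%:R * (C + 2) * L by rewrite !mulr_ge0 ?addr_ge0 // (le_trans _ L1).
  move: (chiH e E) (r%:R * _ * _) => c x x0 nc.
  apply: (@le_trans _ _ (c%:R + x)); first by rewrite ler_wpDr.
  by rewrite ler_peMr // addr_ge0.
have {le} : n%:R + r%:R <= (chiH e E)%:R * (r.-1)%:R + r%:R * m%:R :> R.
  by rewrite -!natrM -!natrD ler_nat.
have : r%:R * m%:R <= r%:R * (C + 2) * L by rewrite -mulrA ler_wpM2l.
have : r%:R * (C + 2) * L <= r%:R * (C + 2) * L * (r.-1)%:R.
  by rewrite ler_peMr // !mulr_ge0 ?addr_ge0 // (le_trans _ L1).
have : 0 <= r%:R :> R by [].
rewrite mulrDl; move: (r%:R * _ * L) (_ * (r.-1)%:R) (r%:R * m%:R) => *; lra.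
Qed.

(* Two rows realising the empty pattern merge into an independent set of
   twice the size. *)
Lemma whp_has_indep t : exists2 C : R, 0 <= C & whp p (fun n E =>
  [forall U : {set 'I_n}, (C * ln (n%:R : R) <= #|U|%:R) ==> has_indep E U (2 ^ t)]).
Proof.
elim: t => [|t [C C0 wC]].
  exists 1 => //; apply: whp_of_fail => eps eps0.
  apply: eventually_mono (eventually_ln (1 : R)) => n L1.
  rewrite [leLHS](_ : _ = 0) ?ltW //.
  rewrite -[RHS](bern_cst (p := p) (upairs n)); apply: eq_bern => E sE.
  rewrite (_ : [forall U, _] = true) //; apply/forallP => U; apply/implyP.
  rewrite mul1r => /(le_trans L1); rewrite ler1n card_gt0 => /set0Pn[x xU].
  apply/existsP; exists [set x]; rewrite sub1set xU cards1 /=.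
  apply/forall_inP => y /set1P->; apply/forall_inP => z /set1P->.
  by rewrite gadj_irr.
set k := (2 ^ t)%N in wC *.
have [C' C'0 wC'] := whp_no_avoiding_rows p01
  (bern_not_pred1_lt1 p01 (set0 : {set 'I_k * 'I_k}) p01s).
exists (C + 1 + k%:R * (C' + 2)); first by rewrite !addr_ge0 // mulr_ge0 // addr_ge0.
apply: (whp_imp2 p01 wC wC').
apply: eventually_mono (eventually_ln (1 : R)) => n L1 E sE /forallP HU none.
set m := (Num.truncn _).+2 in none.
set L := @ln R n%:R in L1 m none HU *.
have mL : m%:R <= (C' + 2) * L.
  have : (Num.truncn (C' * L))%:R <= C' * L.
    by rewrite truncn_le mulr_ge0 // (le_trans _ L1).
  by move=> h; rewrite mulrDl /m -addn2 natrD lerD //; lra.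
clearbody m.
pose u := (Num.truncn (C * L)).+1.
have uL : u%:R <= (C + 1) * L.
  have : (Num.truncn (C * L))%:R <= C * L.
    by rewrite truncn_le mulr_ge0 // (le_trans _ L1).
  by move=> h; rewrite mulrDl mul1r /u -addn1 natrD lerD.
have ug : C * L <= u%:R by rewrite ltW // truncnS_gt.
clearbody u.
apply/forallP => U; apply/implyP => cU.
have umU : (u + k * m <= #|U| + k)%N.
  rewrite (leq_trans _ (leq_addr _ _)) // -(ler_nat R) natrD natrM.
  apply: le_trans cU; rewrite mulrDl lerD // -mulrA ler_wpM2l //.
have [|g [injg gU gind]] := @greedy_rows n k u m
   (fun f => forall a b, ~~ gadj E (f a) (f b)) U _ umU.
  move=> W WU uW; have /existsP[S /and3P[SW kS /forall_inP iS]] : has_indep E W k.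
    by have /implyP := HU W; apply; apply: le_trans ug _; rewrite ler_nat.
  have [f [injf fS]] := set_ord_injection kS; exists f; split=> // [a|a b].
    exact: (subsetP SW).
  by have /forall_inP := iS _ (fS a); apply.
have [i [j [ij cross0]]] : exists i j : 'I_m, (i < j)%N /\ cross E g i j = set0.
  have /existsPn/(_ [ffun q => g q]) := none; rewrite negb_and.
  have -> /= : injectiveb [ffun q => g q].
    by apply/injectiveP => x y; rewrite !ffunE => /injg.
  case/forallPn => i /forallPn[j]; rewrite negb_imply negbK => /andP[ij /eqP ce].
  exists i, j; split=> //; rewrite -ce.
  by apply/setP => ab; rewrite !inE !ffunE.
pose A l : {set 'I_n} := [set g (l, a) | a in [set: 'I_k]].
have cA l : #|A l| = k.
  by rewrite card_imset ?cardsT ?card_ord // => a b /injg[].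
have AA a b : ~~ gadj E (g (i, a)) (g (j, b)).
  by apply/negP => h; have := in_set0 (a, b); rewrite -cross0 inE h.
apply/existsP; exists (A i :|: A j); apply/and3P; split.
- by rewrite subUset; apply/andP; split; apply/subsetP => _ /imsetP[a _ ->].
- rewrite cardsU (_ : _ :&: _ = set0) ?cards0 ?subn0 ?cA ?expnS ?addnn ?mul2n //.
  apply/setP => x; rewrite !inE; apply/andP => -[/imsetP[a _ ->] /imsetP[b _ /injg[e _]]].
  by rewrite e ltnn in ij.
- apply/forall_inP => x xA; apply/forall_inP => y.
  move: xA; rewrite !inE => /orP[]/imsetP[a _ ->] /orP[]/imsetP[b _ ->] //.
  by rewrite gadj_sym.
Qed.

Lemma whp_chiH_upper_k1 (V : finType) (e : rel V) : (3 <= k1 e)%N ->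
  exists K : R, whp p (fun n E =>
    (chiH e E)%:R <= n%:R / ((k1 e).-1)%:R +
      K * (n%:R / logb (1 - p)^-1 n%:R)).
Proof.
move=> k1_ge3; have [C C0 wC] := whp_has_indep (k1 e).-1.
pose r := (k1 e).-2.
have rE : (k1 e).-1 = r.+1 by rewrite /r; lia.
have rk : (r.+1 < k1 e)%N by rewrite -rE; lia.
clearbody r.
have D0 : 0 < ln (1 - p)^-1 by rewrite ln_gt0 // invf_gt1 ?subr_gt0 // gtrBl.
set D := ln _ in D0.
exists ((C + 1) / D); apply: (whp_imp p01 wC).
apply: eventually_mono (eventually_and (eventually_ln (1 : R))
   (eventually_and (eventually_ln_sqr (1 : R)) (eventually_ln_sqr (C + 1)))) => n.
case=> [L1 [Lsq LC]] E sE /forallP HU.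
rewrite /logb -/D; set L := @ln R n%:R in L1 Lsq LC HU *.
have L0 : 0 < L by apply: lt_le_trans L1.
have n0 : 0 <= n%:R :> R by [].
pose u := (Num.truncn (C * L)).+1.
have uL : u%:R <= (C + 1) * L.
  have : (Num.truncn (C * L))%:R <= C * L by rewrite truncn_le mulr_ge0 // ltW.
  by move=> h; rewrite mulrDl mul1r /u -addn1 natrD lerD.
have ug : C * L <= u%:R by rewrite ltW // truncnS_gt.
clearbody u.
have un : (u <= n)%N.
  rewrite -(ler_nat R); apply: le_trans uL _; apply: le_trans LC.
  by rewrite ler_wpM2l ?addr_ge0 // expr2 ler_peMl // ltW.
have [t tr tr'] : exists2 t, (t * r.+1 <= n + r.+1 - u)%N & (n - u <= t * r.+1)%N.
  exists ((n + r.+1 - u) %/ r.+1)%N; first by rewrite leq_divM.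
  have := ltn_ceil (n + r.+1 - u) (ltn0Sn r); rewrite mulSn.
  by rewrite -addnBAC // addnC ltn_add2l => /ltnW.
have [||g [injg _ gind]] := @greedy_rows n r.+1 u t
   (fun f => forall a b, ~~ gadj E (f a) (f b)) [set: 'I_n].
- move=> W _ uW; have /existsP[S /and3P[SW kS /forall_inP iS]] :
      has_indep E W (2 ^ (k1 e).-1).
    by have /implyP := HU W; apply; apply: le_trans ug _; rewrite ler_nat.
  have kS' : (r.+1 <= #|S|)%N.
    by apply: leq_trans kS; rewrite rE; apply: ltnW; apply: ltn_expl.
  have [f [injf fS]] := set_ord_injection kS'; exists f; split=> // [a|a b].
    exact: (subsetP SW).
  by have /forall_inP := iS _ (fS a); apply.
- by rewrite cardsT card_ord mulnC -leq_subRL // (leq_trans un (leq_addr _ _)).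
have le : (chiH e E <= n - t * r)%N.
  by apply: chiH_le_rows injg gind (gadj_irr sE) rk.
have le2 : (chiH e E * r.+1 <= n + u * r.+1)%N.
  have h1 : (chiH e E * r.+1 <= n * r.+1 - t * r.+1 * r)%N.
    by rewrite mulnAC -mulnBl leq_mul2r le orbT.
  have h2 : (n * r - u * r <= t * r.+1 * r)%N by rewrite -mulnBl leq_mul2r tr' orbT.
  move: (t * r.+1 * r)%N h1 h2 => T h1; rewrite leq_subLR => h2.
  apply: leq_trans h1 _; rewrite leq_subLR !mulnS addnCA leq_add2l.
  by apply: leq_trans h2 _; rewrite addnC leq_add2l leq_addl.
have {}le2 : (chiH e E)%:R * r.+1%:R <= n%:R + u%:R * r.+1%:R :> R.
  by rewrite -!natrM -natrD ler_nat.
rewrite rE; have r0 : 0 < r.+1%:R :> R by rewrite ltr0n.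
apply: (@le_trans _ _ (n%:R / r.+1%:R + u%:R)).
  by rewrite -(ler_pM2r r0) mulrDl divfK ?gt_eqF.
rewrite lerD2l; apply: le_trans uL _.
rewrite (_ : _ / D * _ = (C + 1) * (n%:R / L)); last by field; rewrite !gt_eqF.
rewrite ler_wpM2l ?addr_ge0 // ler_pdivlMr //.
by rewrite -expr2 -[leLHS]mul1r.
Qed.

End Bounds.

Lemma twoK2_pat_rev n m (E : {set 'I_n * 'I_n}) (g : 'I_m * 'I_2 -> 'I_n) i j :
  twoK2_pat (cross E g j i) = twoK2_pat (cross E g i j).
Proof.
have H i' j' (f : rel 'I_2) : symmetric f ->
    cross E g j' i' == [set ab | f ab.1 ab.2] ->
    cross E g i' j' == [set ab | f ab.1 ab.2].
  move=> fsym /eqP/setP h; apply/eqP/setP => -[a b].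
  by have := h (b, a); rewrite !inE /= gadj_sym fsym.
have sd : symmetric (fun a b : 'I_2 => a == b) by move=> a b; exact: eq_sym.
have sn : symmetric (fun a b : 'I_2 => a != b) by move=> a b; rewrite eq_sym.
by congr orb; apply/idP/idP; (exact: H sd || exact: H sn).
Qed.

Lemma card_avoiding_twoK2 n m (E : {set 'I_n * 'I_n}) (g : 'I_m * 'I_2 -> 'I_n) :
  injective g -> avoids twoK2_pat E g ->
  (m`! <= #|[set g : {ffun 'I_m * 'I_2 -> 'I_n} |
             injectiveb g && avoids twoK2_pat E g]|)%N.
Proof.
move=> injg /forallP av.
have av' i j : i != j -> ~~ twoK2_pat (cross E g i j).
  rewrite neq_ltn => /orP[ij|ji].
    by have /forallP/(_ j)/implyP/(_ ij) := av i.
  by rewrite -twoK2_pat_rev; have /forallP/(_ i)/implyP/(_ ji) := av j.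
pose F (s : {perm 'I_m}) : {ffun 'I_m * 'I_2 -> 'I_n} := [ffun q => g (s q.1, q.2)].
have injF : injective F.
  move=> s s' /ffunP e; apply/permP => i.
  by have := e (i, ord0); rewrite !ffunE => /injg[].
rewrite -card_Sn -cardsT -(card_imset _ injF); apply/subset_leq_card/subsetP.
move=> _ /imsetP[s _ ->]; rewrite inE; apply/andP; split.
  by apply/injectiveP => -[i a] [j b]; rewrite !ffunE => /injg[/perm_inj-> ->].
apply/forallP => i; apply/forallP => j; apply/implyP => ij.
rewrite (_ : cross E (F s) i j = cross E g (s i) (s j)); last first.
  by apply/setP => ab; rewrite !inE !ffunE.
by apply: av'; rewrite (inj_eq perm_inj) neq_ltn ij.
Qed.

Lemma bern_twoK2_pat (R : realType) (p : R) :
  bern p [set: 'I_2 * 'I_2] (fun M => (~~ twoK2_pat M)%:R) =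
  1 - 2 * p ^+ 2 * (1 - p) ^+ 2.
Proof.
pose A : {set 'I_2 * 'I_2} := [set ab | ab.1 == ab.2].
pose B : {set 'I_2 * 'I_2} := [set ab | ab.1 != ab.2].
have cA : #|A| = 2%N.
  have -> : A = [set (x, x) | x in [set: 'I_2]].
    apply/setP => -[a b]; rewrite inE /=; apply/eqP/imsetP => [->|[x _ [-> ->]]//].
    by exists b; rewrite ?in_setT.
  by rewrite card_imset ?cardsT ?card_ord // => a b [].
have AB : B = ~: A by apply/setP => ab; rewrite !inE.
have c4 : #|[set: 'I_2 * 'I_2]| = 4%N by rewrite cardsT card_prod card_ord.
have cB : #|B| = 2%N.
  by have := cardsC A; rewrite -AB cA -cardsT c4; lia.
have neAB : A != B.
  apply/eqP => /setP/(_ (ord0, ord0)); by rewrite !inE.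
have b1 (M : {set 'I_2 * 'I_2}) : #|M| = 2%N ->
    bern p [set: 'I_2 * 'I_2] (fun X => (X == M)%:R) = p ^+ 2 * (1 - p) ^+ 2.
  move=> cM; rewrite /bern (bigD1 M) ?subsetT //= eqxx mulr1 cM c4.
  by rewrite big1 ?addr0 // => X /andP[_ /negbTE->]; rewrite mulr0.
have : bern p [set: 'I_2 * 'I_2] (fun M => (~~ twoK2_pat M)%:R) +
    (bern p [set: 'I_2 * 'I_2] (fun X => (X == A)%:R) +
     bern p [set: 'I_2 * 'I_2] (fun X => (X == B)%:R)) = 1.
  rewrite -!bernD -[RHS](bern_cst (p := p) [set: 'I_2 * 'I_2]).
  apply: eq_bern => X _; rewrite /twoK2_pat -/A -/B.
  case: (eqVneq X A) => [->|_]; first by rewrite (negbTE neAB) add0r addr0.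
  by case: (X == B); rewrite /= ?add0r ?addr0.
by rewrite !b1 // => h; lra.
Qed.

Section IndependentSets.
Context {R : realType} {p : R}.
Hypotheses (hp0 : 0 < p) (hp1 : p < 1).

Let p01 : 0 <= p <= 1. Proof. by rewrite !ltW. Qed.
Let p01s : 0 < p < 1. Proof. by rewrite hp0. Qed.
Let D : R := ln (1 - p)^-1.
Let D0 : 0 < D. Proof. by rewrite ln_gt0 // invf_gt1 ?subr_gt0 // gtrBl. Qed.

Definition indep_target (n : nat) : nat :=
  Num.truncn ((2 * ln (n%:R : R) - 6 * ln (ln (n%:R : R))) / D).

Lemma whp_indep_set : whp p (fun n E => [exists S : {set 'I_n},
   (#|S| == indep_target n) && (E :&: inner_pairs S == set0)]).
Proof.
apply: whp_of_fail => eps eps0.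
pose del := Num.min eps 2^-1.
have del0 : 0 < del by rewrite lt_min eps0 invr_gt0 ltr0n.
apply: eventually_mono (eventually_and
  (eventually_and (eventually_ln (1 : R)) (eventually_ln D))
  (eventually_and
    (eventually_and (eventually_ln (4 / (D ^+ 2 * del))) (eventually_lnln (0 : R)))
  (eventually_and (eventually_lnln_ln (6 : R)) (eventually_ln_sqr (2 / D))))) => n.
move=> [[L1 LD] [[Ldel l0] [lL Lsq]]].
rewrite /indep_target.
set L := @ln R n%:R in L1 LD Ldel l0 lL Lsq *; set l := ln L in l0 lL *.
have L0 : 0 < L by apply: lt_le_trans L1.
have n0 : 0 < n%:R :> R.
  rewrite lt_neqAle ler0n andbT; apply/eqP => n0; move: L0.
  by rewrite /L -n0 ln0 // ltxx.
have z1 : 1 <= (2 * L - 6 * l) / D by rewrite ler_pdivlMr // mul1r; lra.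
set k := Num.truncn _.
have kz : k%:R <= (2 * L - 6 * l) / D by rewrite truncn_le (le_trans _ z1).
have k_gt0 : (0 < k)%N by rewrite truncn_gt0.
clearbody k.
have kL : k%:R <= 2 * L / D.
  by apply: le_trans kz _; rewrite ler_pM2r ?invr_gt0 //; lra.
have kn : (k <= n)%N.
  rewrite -(ler_nat R); apply: le_trans kL _; apply: le_trans Lsq.
  rewrite mulrAC ler_pM2l ?divr_gt0 // expr2 ler_peMl // ltW //.
pose sd := expR (D / 2).
have sdE : sd ^+ 2 = (1 - p)^-1.
  by rewrite -expRM_natl mulrC divfK ?pnatr_eq0 // lnK // posrE invr_gt0 subr_gt0.
have sd1 : 1 <= sd by rewrite -expR0 ler_expR divr_ge0 // ltW.
have xdel : k%:R ^+ 2 * sd ^+ k / n%:R <= del.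
  have sdk : sd ^+ k <= n%:R / L ^+ 3.
    rewrite -expRM_natl -[n%:R]lnK ?posrE // expr_expR_ln // -expRB ler_expR -/L -/l.
    by rewrite mulrA ler_pdivrMr //; move: kz; rewrite ler_pdivlMr //; lra.
  apply: (@le_trans _ _ ((2 * L / D) ^+ 2 * (n%:R / L ^+ 3) / n%:R)).
    rewrite ler_pM2r ?invr_gt0 //; apply: ler_pM => //.
    - exact: exprn_ge0.
    - by rewrite exprn_ge0 // expR_ge0.
    by rewrite lerXn2r ?nnegrE // divr_ge0 ?mulr_ge0 // ltW.
  rewrite (_ : _ / n%:R = 4 / D ^+ 2 / L); last by field; rewrite !gt_eqF.
  rewrite !ler_pdivrMr ?exprn_gt0 //; move: Ldel.
  rewrite ler_pdivrMr ?mulr_gt0 ?exprn_gt0 //.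
  by rewrite (_ : L * _ = del * L * D ^+ 2) //; ring.
have x2 : k%:R ^+ 2 * sd ^+ k / n%:R <= 2^-1.
  by apply: le_trans xdel _; rewrite ge_min lexx orbT.
apply: le_trans (prob_no_indep_set p01s sd1 sdE k_gt0 kn x2) _.
have : k%:R ^+ 2 * sd ^+ k / n%:R <= eps by apply: le_trans xdel _; rewrite ge_min lexx.
have : 0 <= k%:R ^+ 2 * sd ^+ k / n%:R.
  by rewrite divr_ge0 // mulr_ge0 // exprn_ge0 // ltW // expR_gt0.
by move: x2; set x := _ / n%:R => x2 x0 xe; nra.
Qed.

Lemma whp_chiH_upper_k2 (V : finType) (e : rel V) : (1 < k2 e)%N ->
  exists K : R, whp p (fun n E =>
    (chiH e E)%:R <= n%:R - 2 * logb (1 - p)^-1 n%:R + K * logb (1 - p)^-1 (ln n%:R)).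
Proof.
move=> k2_gt1; exists 7; apply: (whp_imp p01 whp_indep_set).
apply: eventually_mono (eventually_and (eventually_ln D)
  (eventually_and (eventually_lnln (2 * D)) (eventually_lnln_ln (6 : R)))) => n.
move=> [LD [lD lL]] E sE /existsP[S /andP[/eqP cS /eqP ES]].
rewrite /logb -/D; rewrite /indep_target in cS.
set L := @ln R n%:R in LD lD lL cS *; set l := ln L in lD lL cS *.
have z1 : 1 <= (2 * L - 6 * l) / D by rewrite ler_pdivlMr // mul1r; lra.
have kz := truncnS_gt ((2 * L - 6 * l) / D).
have k_gt0 : (0 < Num.truncn ((2 * L - 6 * l) / D))%N by rewrite truncn_gt0.
move: (Num.truncn _) cS kz k_gt0 => [//|k] cS kz _.
have [f [injf fS]] := @set_ord_injection _ S k.+1 (eq_leq (esym cS)).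
have injg : injective (fun q : 'I_1 * 'I_k.+1 => f q.2).
  by move=> [i a] [j b] /= /injf ->; rewrite !ord1.
have ind (i : 'I_1) a b : ~~ gadj E (f a) (f b).
  rewrite gadj_edge // negb_and negbK; have [//|/= ne] := eqVneq.
  have := edge_upairs ne => eu.
  apply/negP => eE; have := in_set0 (edge (f a) (f b)); rewrite -ES !inE eE.
  move: eu; rewrite inE => -> /=.
  by rewrite /edge; case: ifP => _ /=; rewrite !fS.
have le := chiH_le_one_row injg ind (erefl 1%N) (gadj_irr sE) k2_gt1.
have kn : (k <= n)%N.
  by have := max_card S; rewrite cS card_ord; exact: ltnW.
have {le} : (chiH e E)%:R <= n%:R - k%:R :> R by rewrite -natrB // ler_nat.
move=> le; apply: le_trans le _.
rewrite -[k.+2]addn2 natrD in kz.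
have l2 : 2 <= l / D by rewrite ler_pdivlMr.
have e1 : (2 * L - 6 * l) / D = 2 * (L / D) - 6 * (l / D) by ring.
rewrite e1 in kz; lra.
Qed.

Lemma whp_chiH_twoK2_lower :
  let Q : R := 1 - 2 * p ^+ 2 * (1 - p) ^+ 2 in
  whp p (fun n E =>
    n%:R - 8 * logb Q^-1 n%:R + 2 * logb Q^-1 (ln n%:R) <= (chiH twoK2 E)%:R).
Proof.
move=> Q.
have Q0 : 0 < Q.
  have h : p * (1 - p) <= 4^-1 by have := sqr_ge0 (p - 2^-1); lra.
  have h0 : 0 <= p * (1 - p) by rewrite mulr_ge0 ?subr_ge0 ?(ltW hp0) ?(ltW hp1).
  rewrite /Q -mulrA -exprMn; move: (p * (1 - p)) h h0 => w h h0; nra.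
have Q1 : Q < 1.
  suff : 0 < 2 * p ^+ 2 * (1 - p) ^+ 2 by rewrite /Q; lra.
  by rewrite !mulr_gt0 ?exprn_gt0 ?subr_gt0.
have lnQ : ln Q^-1 = - ln Q by rewrite lnV.
pose lam := ln Q^-1.
have lam0 : 0 < lam by rewrite ln_gt0 // invf_gt1.
pose z n := (4 * ln (n%:R : R) - ln (ln (n%:R : R))) / lam.
have wnone : whp p (fun n E =>
    ~~ [exists g : {ffun 'I_(Num.truncn (z n)).+1 * 'I_2 -> 'I_n},
      injectiveb g && avoids twoK2_pat E g]).
  apply: whp_of_fail => eps eps0.
  apply: eventually_mono (eventually_and
    (eventually_and (eventually_ln (1 : R)) (eventually_ln (- ln eps * lam)))
    (eventually_and (eventually_lnln (lam + 4 + 2 * ln lam))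
       (eventually_lnln_ln (1 : R)))) => n [[L1 Leps] [l0 lL]].
  rewrite /z; set L := @ln R n%:R in L1 Leps l0 lL *; set l := ln L in l0 lL *.
  have L0 : 0 < L by apply: lt_le_trans L1.
  have n0 : 0 < n%:R :> R.
    rewrite lt_neqAle ler0n andbT; apply/eqP => n0; move: L0.
    by rewrite /L -n0 ln0 // ltxx.
  set m := (Num.truncn _).+1.
  have mz : (4 * L - l) / lam < m%:R by exact: truncnS_gt.
  have m0 : 0 < m%:R :> R by rewrite ltr0n.
  have := prob_exists_avoids p01 (@card_avoiding_twoK2 n m).
  rewrite bern_twoK2_pat -/Q => H.
  clearbody m.
  rewrite [leLHS](_ : _ = gnp_prob p (fun E => [exists g : {ffun 'I_m * 'I_2 -> 'I_n},
          injectiveb g && avoids twoK2_pat E g])); last first.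
    by apply: eq_bern => E _; rewrite negbK.
  have f0 : 0 < m`!%:R :> R by rewrite ltr0n fact_gt0.
  rewrite -(ler_pM2r f0); apply: le_trans H _.
  apply: (@le_trans _ _ (eps * expR (m%:R * (ln m%:R - 1)))); last first.
    by rewrite ler_pM2l // fact_ge_expR.
  rewrite !expr_expR_ln // -expRD -[eps]lnK ?posrE // -expRD ler_expR.
  rewrite -/L bin2_real natrM (_ : ln Q = - lam); last by rewrite /lam lnQ opprK.
  have mz' : 4 * L - l < m%:R * lam by rewrite -ltr_pdivrMr.
  have lnm : l - ln lam <= ln m%:R.
    rewrite -ln_div ?posrE // ler_ln ?posrE ?divr_gt0 //.
    by rewrite ler_pdivrMr //; lra.
  have me : - ln eps <= m%:R.
    by rewrite -(ler_pM2r lam0); lra.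
  suff : m%:R * (2 * L - lam * (m%:R - 1) / 2 - ln m%:R + 1) <= - m%:R by lra.
  rewrite -[leRHS]mulrN1 ler_pM2l //.
  by rewrite mulrBr mulr1; lra.
apply: (whp_imp p01 wnone).
apply: eventually_mono (eventually_and (eventually_ln (0 : R))
  (eventually_lnln_ln (4 : R))).
move=> n [L0 lL] E sE none.
rewrite /logb -/lam.
have zz : z n = 4 * (ln n%:R / lam) - ln (ln n%:R) / lam by rewrite /z; ring.
have z0 : 0 <= z n.
  by rewrite /z divr_ge0 ?(ltW lam0) //; lra.
have := chiH_lower (fun k c g => @twoK2_avoids n k E c _ g) none.
case/orP => [lt|].
  have : n%:R <= (chiH twoK2 E)%:R :> R by rewrite ler_nat ltnW.
  by lra.
move=> le; have : n%:R <= (chiH twoK2 E)%:R + 2 * (Num.truncn (z n))%:R :> R.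
  by rewrite -natrM -natrD ler_nat; move: le; rewrite muln1 mulnS addnCA addnC leq_add2l.
have : (Num.truncn (z n))%:R <= z n by rewrite truncn_le.
by lra.
Qed.

End IndependentSets.

Theorem theorem3 (R : realType) (p : R) (hp0 : 0 < p) (hp1 : p < 1) :
  let d : R := (1 - p)^-1 in
  (forall (V : finType) (e : rel V), simple_graph e -> bipartite e ->
     (* (i) *)
     ((3 <= k1 e)%N -> (2 <= k2 e)%N ->
        exists C : R, exists K : R,
          whp p (fun n E =>
            (n%:R / ((k1 e).-1)%:R - C * ln n%:R <= (chiH e E)%:R) &&
            ((chiH e E)%:R <= n%:R / ((k1 e).-1)%:R + K * (n%:R / logb d n%:R))))
     /\
     (* (ii) *)
     (k1 e = 2%N -> k2 e = 2%N ->
        exists C : R, exists K : R,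
          whp p (fun n E =>
            (n%:R - C * ln n%:R <= (chiH e E)%:R) &&
            ((chiH e E)%:R <= n%:R - 2 * logb d n%:R + K * logb d (ln n%:R)))))
  /\
  (* (iii) *)
  (let Q : R := 1 - 2 * p ^+ 2 * (1 - p) ^+ 2 in
   exists c : R, exists K : R, 0 < c /\
     whp p (fun n E =>
       (n%:R - 8 * logb Q^-1 n%:R + c * logb Q^-1 (ln n%:R) <= (chiH twoK2 E)%:R) &&
       ((chiH twoK2 E)%:R <= n%:R - 2 * logb d n%:R + K * logb d (ln n%:R)))).
Proof.
move=> d.
have p01 : 0 <= p <= 1 by rewrite !ltW.
have whp_and (P Q : forall n : nat, {set 'I_n * 'I_n} -> bool) :
    whp p P -> whp p Q -> whp p (fun n E => P n E && Q n E).
  by move=> wP wQ; apply: (whp_imp2 p01 wP wQ); exists 0%N => n _ E _ -> ->.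
split=> [V e simp bip|Q].
  split=> [k1_ge3 k2_ge2|k1_eq2 k2_eq2].
    have [C wC] := whp_chiH_lower hp0 hp1 simp bip (ltnW k1_ge3) k2_ge2.
    have [K wK] := whp_chiH_upper_k1 hp0 hp1 k1_ge3.
    by exists C, K; apply: whp_and.
  have k1_gt1 : (1 < k1 e)%N by rewrite k1_eq2.
  have k2_gt1 : (1 < k2 e)%N by rewrite k2_eq2.
  have [C wC] := whp_chiH_lower hp0 hp1 simp bip k1_gt1 k2_gt1.
  have [K wK] := whp_chiH_upper_k2 hp0 hp1 k2_gt1.
  exists C, K; apply: whp_and => //; apply: (whp_imp p01 wC).
  by exists 0%N => n _ E _; rewrite k1_eq2 divr1.
have [K wK] := whp_chiH_upper_k2 hp0 hp1 twoK2_k2.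
by exists 2, K; split=> //; apply: whp_and => //; apply: whp_chiH_twoK2_lower.
Qed.
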